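(* Let $p\in(0,1]$, $\theta>0$, let $f_j:\mathbb{R}^n\to\mathbb{R}$, $j\in\{0\}\cup\mathcal I\cup\mathcal E$, be continuously differentiable, with $\mathcal I,\mathcal E$ finite index sets, and put $\phi(x)=\sum_{i=1}^n|x_i|^p$, $\Theta=\{x\mid\phi(x)\le\theta\}$ and $\Gamma=\{x\mid f_j(x)\le0\ \forall j\in\mathcal I,\ f_j(x)=0\ \forall j\in\mathcal E\}$. Suppose $\bar x\in\Gamma\cap\Theta$ with $\bar x\in\partial\Theta$ is a local minimizer of the problem $(\mathscr P_2)$: minimize $f_0(x)$ over $x\in\Theta\cap\Gamma$. Write $\bar{\mathcal N}=\{i\mid\bar x_i\ne0\}$ and $\bar{\mathcal A}=\{j\in\mathcal I\mid f_j(\bar x)=0\}$. (a) If the EMFCQ for $(\mathscr P_2)$ holds at $\bar x$, then there exist $y_j\in\mathbb{R}$, $j\in\mathcal E$, and $y_j\ge0$, $j\in\{0\}\cup\bar{\mathcal A}$, such that $$\nabla_if_0(\bar x)+y_0\,p\,\mathrm{sign}(\bar x_i)|\bar x_i|^{p-1}+\sum_{j\in\bar{\mathcal A}\cup\mathcal E}y_j\nabla_if_j(\bar x)=0,\qquad i\in\bar{\mathcal N}.$$ (b) Suppose $\Gamma$ is closed and convex. If $v=0$ is the only vector such that $v\in N_\Theta(\bar x)$ and $-v\in N_\Gamma(\bar x)$, then $N_{\Theta\cap\Gamma}(\bar x)=N_\Theta(\bar x)+N_\Gamma(\bar x)$. Therefore, there exist $y_0\ge0$ and $v\in N_\Gamma(\bar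 x)$ such that $$\nabla_if_0(\bar x)+y_0\,p\,\mathrm{sign}(\bar x_i)|\bar x_i|^{p-1}+v_i=0,\qquad i\in\bar{\mathcal N}.$$ (c) Suppose $\Gamma=\mathbb{R}^n$. Then there exists $y_0\ge0$ such that $$\nabla_if_0(\bar x)+y_0\,p\,\mathrm{sign}(\bar x_i)|\bar x_i|^{p-1}=0,\qquad i\in\bar{\mathcal N}.$$
   Context: $\partial\Theta$ denotes the topological boundary of $\Theta$. For a vector $u$, $u_{\bar{\mathcal N}}$ is the subvector with indices in $\bar{\mathcal N}$, and $\nabla_{\bar{\mathcal N}}f_j(\bar x)=(\nabla_if_j(\bar x))_{i\in\bar{\mathcal N}}$. EMFCQ for $(\mathscr P_2)$ holds at $\bar x\in\partial\Theta\cap\Gamma$ if the subvectors $\nabla_{\bar{\mathcal N}}f_j(\bar x)$, $j\in\mathcal E$, are linearly independent and there exists $d\in\mathbb{R}^{|\bar{\mathcal N}|}$ such that $\langle p\,\mathrm{sign}(\bar x_{\bar{\mathcal N}})|\bar x_{\bar{\mathcal N}}|^{p-1},d\rangle<0$ (componentwise operations), $\langle\nabla_{\bar{\mathcal N}}f_j(\bar x),d\rangle=0$ for $j\in\mathcal E$, and $\langle\nabla_{\bar{\mathcal N}}f_j(\bar x),d\rangle<0$ for $j\in\bar{\mathcal A}$. Equivalently (dual form): the only solution of $y_0\,p\,\mathrm{sign}(\bar x_i)|\bar x_i|^{p-1}+\sum_{j\in\bar{\mathcal A}\cup\mathcal E}y_j\nabla_if_j(\bar x)=0$ for all $i\in\bar{\mathcal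 N}$, with $y_j\ge0$ for $j\in\{0\}\cup\bar{\mathcal A}$ and $y_j\in\mathbb{R}$ for $j\in\mathcal E$, is $y=0$. For $C\subset\mathbb{R}^n$ and $\bar x\in C$: $v\in\widehat N_C(\bar x)$ (regular normal) if $\limsup_{x\to\bar x,\,x\in C,\,x\ne\bar x}\langle v,x-\bar x\rangle/\|x-\bar x\|\le0$; $v\in N_C(\bar x)$ (general normal) if there are $x^\nu\in C$, $x^\nu\to\bar x$ and $v^\nu\in\widehat N_C(x^\nu)$ with $v^\nu\to v$. *)

(* Defs.v *)
From HB Require Import structures.
From mathcomp Require Import all_boot all_order all_algebra.
From mathcomp Require Import all_classical all_reals all_analysis.

Set Implicit Arguments.
Unset Strict Implicit.
Unset Printing Implicit Defensive.

Import Order.TTheory GRing.Theory Num.Theory.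
Import numFieldNormedType.Exports.

Local Open Scope classical_set_scope.
Local Open Scope ring_scope.

Section Vectors.
Context {R : realType} {n : nat}.
Implicit Types (u v x : 'rV[R]_n) (f : 'rV[R]_n -> R) (C : set 'rV[R]_n).

Definition dot u v : R := \sum_(i < n) u 0 i * v 0 i.

(* The library norm on ['rV[R]_n] is the sup norm; it induces the same
   topology as this one. *)
Definition enorm u : R := Num.sqrt (dot u u).

Definition subvec (N : {pred 'I_n}) u : 'rV[R]_#|N| := colsub enum_val u.

Definition grad f x : 'rV[R]_n := \row_(i < n) 'D_(delta_mx 0 i) f x.

Definition C1 f : Prop := (forall x, differentiable f x) /\ continuous (grad f).

Definition boundary C : set 'rV[R]_n := closure C `\` C°.

Definition local_minimizer f C x : Prop :=
  C x /\ \forall y \near x, C y -> f x <= f y.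

(* Used only at points x of C. If x is isolated in C, the limsup is -oo, so
   that every vector is normal. *)
Definition regular_normal_cone C x : set 'rV[R]_n :=
  [set v | (limf_esup (fun y : 'rV[R]_n => (dot v (y - x) / enorm (y - x))%:E)
              (within C x^') <= 0)%E].

Definition normal_cone C x : set 'rV[R]_n :=
  [set v | exists (xs vs : nat -> 'rV[R]_n),
     [/\ forall k, C (xs k), xs @ \oo --> x,
         forall k, regular_normal_cone C (xs k) (vs k) & vs @ \oo --> v]].

End Vectors.

Section Problem.
Context {R : realType} {n : nat} {I E : finType}.
Variables (p theta : R) (fI : I -> 'rV[R]_n -> R) (fE : E -> 'rV[R]_n -> R).
Implicit Type x : 'rV[R]_n.

Definition phi x : R := \sum_(i < n) `|x 0 i| `^ p.

Definition Theta : set 'rV[R]_n := [set x | phi x <= theta].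

Definition Gamma : set 'rV[R]_n :=
  [set x | (forall j, fI j x <= 0) /\ (forall j, fE j x = 0)].

Definition nonzeros x : {pred 'I_n} := [pred i | x 0 i != 0].

Definition active x : {pred I} := [pred j | fI j x == 0].

(* Meaningful only for i in [nonzeros x], where it is the i-th partial
   derivative of [phi] at x. *)
Definition dphi x (i : 'I_n) : R := p * Num.sg (x 0 i) * `|x 0 i| `^ (p - 1).

Definition EMFCQ x : Prop :=
  let N := nonzeros x in
  free [seq subvec N (grad (fE j) x) | j : E] /\
  exists d : 'rV[R]_#|N|,
    [/\ dot (subvec N (\row_i dphi x i)) d < 0,
        forall j, dot (subvec N (grad (fE j) x)) d = 0 &
        forall j, j \in active x -> dot (subvec N (grad (fI j) x)) d < 0].

End Problem.

(* Main.v *)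
Require Import Defs.
From HB Require Import structures.
From mathcomp Require Import all_boot all_order all_algebra.
From mathcomp Require Import all_classical all_reals all_analysis.
From mathcomp Require Import ring lra.

Set Implicit Arguments.
Unset Strict Implicit.
Unset Printing Implicit Defensive.

Import Order.TTheory GRing.Theory Num.Theory.
Import numFieldNormedType.Exports.

Local Open Scope classical_set_scope.
Local Open Scope ring_scope.

(** The function [phi] is not differentiable at [xbar] in the coordinates that
    vanish there. All conclusions, however, only concern the coordinates in
    [N := nonzeros xbar], and on the face of the points that vanish off [N] the
    function [phi] is smooth near [xbar], with partial derivatives [dphi]. It
    is therefore enough to move inside that face whenever [phi] has to decrease.

    For (a), the problem restricted to the face is a smooth one, and its Fritz
    John conditions ([fritz_john]) come from penalization: the minimizers, over
    a compact piece of the face, of [f0], plus the squared distance to [xbar],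
    plus [k] times the squared constraint violation, tend to [xbar], and their
    stationarity equations, divided by the size of the multipliers, pass to the
    limit by compactness. EMFCQ, in its dual form [EMFCQ_dual], forbids the
    multiplier of [f0] from vanishing.

    For (c), [- grad f0 xbar] is a regular normal to [Theta] at [xbar]. A
    direction of the face along which [phi] decreases stays in [Theta], so that
    a regular normal is nonpositive on a half-space of the face, which makes it
    a nonnegative multiple of [dphi] on [N] ([Theta_regular_normal]). This
    description survives limits ([Theta_normal]).

    For (b), a normal to an intersection of two closed sets is a sum of normals
    as soon as no nonzero normals cancel ([normal_cone_setI_sub]). Penalizing
    the distance between a point of one set and a point of the other shows this
    up to a small error ([fuzzy_normal_setI]); the qualification then bounds the
    two summands, and compactness removes the error. The converse inclusion is
    immediate for regular normals, and at [xbar] all normals are regular: to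
    [Gamma] by convexity; to [Theta] by convexity if [p = 1], and if [p < 1]
    because [`|t| `^ p] dominates every multiple of [t] near [0]
    ([Theta_normal_regular]). Applied to [- grad f0 xbar], the sum rule and
    [Theta_normal] give the multiplier equation. *)

(** * Euclidean products and normal cones *)

Lemma cvg_fsum (R : realType) (T : Type) (F : set_system T) {FF : Filter F}
    (J : finType) (f : J -> T -> R) (a : J -> R) :
  (forall j, f j @ F --> a j) -> \sum_j f j t @[t --> F] --> \sum_j a j.
Proof.
move=> fa; elim: (index_enum J) => [|j r ih].
  by under eq_cvg do rewrite big_nil; rewrite big_nil; exact: cvg_cst.
by under eq_cvg do rewrite big_cons; rewrite big_cons; exact: cvgD.
Qed.

Section Euclid.
Context {R : realType} {n : nat}.
Implicit Types (u v w x y : 'rV[R]_n) (C D : set 'rV[R]_n).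

Lemma dotC u v : dot u v = dot v u.
Proof. by apply: eq_bigr => i _; rewrite mulrC. Qed.

Lemma dotDl u v w : dot (u + v) w = dot u w + dot v w.
Proof. by rewrite -big_split; apply: eq_bigr => i _; rewrite mxE mulrDl. Qed.

Lemma dotZl (a : R) u w : dot (a *: u) w = a * dot u w.
Proof. by rewrite mulr_sumr; apply: eq_bigr => i _; rewrite mxE mulrA. Qed.

Lemma dotNl u w : dot (- u) w = - dot u w.
Proof. by rewrite -scaleN1r dotZl mulN1r. Qed.

Lemma dotBl u v w : dot (u - v) w = dot u w - dot v w.
Proof. by rewrite dotDl dotNl. Qed.

Lemma dotDr w u v : dot w (u + v) = dot w u + dot w v.
Proof. by rewrite dotC dotDl !(dotC _ w). Qed.

Lemma dotZr (a : R) w u : dot w (a *: u) = a * dot w u.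
Proof. by rewrite dotC dotZl dotC. Qed.

Lemma dotNr w u : dot w (- u) = - dot w u.
Proof. by rewrite dotC dotNl dotC. Qed.

Lemma dotBr w u v : dot w (u - v) = dot w u - dot w v.
Proof. by rewrite dotDr dotNr. Qed.

Lemma dot0l w : dot 0 w = 0.
Proof. by rewrite -(scale0r w) dotZl mul0r. Qed.

Lemma dot_delta u i : dot u (delta_mx 0 i) = u 0 i.
Proof.
rewrite /dot (bigD1 i)//= mxE !eqxx mulr1 big1 ?addr0// => j ji.
by rewrite mxE (negbTE ji) andbF mulr0.
Qed.

Lemma dot_ge0 u : 0 <= dot u u.
Proof. by apply: sumr_ge0 => i _; rewrite -expr2 sqr_ge0. Qed.

Lemma coord_le_norm u i : `|u 0 i| <= `|u|.
Proof.
rewrite [leRHS]/Num.norm /= mx_normrE.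
by apply/bigmax_geP; right; exists (0, i).
Qed.

Lemma norm_le_coord u (r : R) : 0 <= r -> (forall i, `|u 0 i| <= r) -> `|u| <= r.
Proof.
move=> r0 h; rewrite [leLHS]/Num.norm /= mx_normrE.
by apply/bigmax_leP; split => // -[j i] _; rewrite ord1 /=.
Qed.

Lemma norm_sqr_le_dot u : `|u| ^+ 2 <= dot u u.
Proof.
have h : `|u| <= Num.sqrt (dot u u).
  apply: norm_le_coord => [|i]; first exact: sqrtr_ge0.
  rewrite -sqrtr_sqr ler_wsqrtr// expr2 /dot (bigD1 i)//= lerDl.
  by apply: sumr_ge0 => j _; rewrite -expr2 sqr_ge0.
by rewrite -(sqr_sqrtr (dot_ge0 u)) ler_pXn2r // nnegrE ?sqrtr_ge0.
Qed.

Lemma norm_dot_le u v : `|dot u v| <= n.+1%:R * `|u| * `|v|.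
Proof.
apply: (le_trans (ler_norm_sum _ _ _)).
apply: (@le_trans _ _ (\sum_(i < n) `|u| * `|v|)).
  by apply: ler_sum => i _; rewrite normrM ler_pM ?coord_le_norm.
rewrite sumr_const card_ord -mulrA mulr_natl; apply: ler_wpMn2l; rewrite ?mulr_ge0//.

Qed.

Lemma dot_le_norm_sqr u : dot u u <= n.+1%:R * `|u| ^+ 2.
Proof. by rewrite expr2 mulrA (le_trans (ler_norm _))// norm_dot_le. Qed.

Lemma norm_le_enorm u : `|u| <= enorm u.
Proof.
rewrite -(ler_pXn2r (isT : (0 < 2)%N)) ?nnegrE ?sqrtr_ge0//.
by rewrite sqr_sqrtr ?dot_ge0// norm_sqr_le_dot.
Qed.

Lemma enorm_le_norm u : enorm u <= n.+1%:R * `|u|.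
Proof.
rewrite -(ler_pXn2r (isT : (0 < 2)%N)) ?nnegrE ?sqrtr_ge0// ?mulr_ge0//.
rewrite sqr_sqrtr ?dot_ge0// (le_trans (dot_le_norm_sqr _))// exprMn.
by rewrite ler_wpM2r ?sqr_ge0// -natrX ler_nat expnS expn1 leq_pmulr.
Qed.

Lemma cvg_coord (T : Type) (F : set_system T) {FF : Filter F}
    (f : T -> 'rV[R]_n) u i : f @ F --> u -> (f t 0 i) @[t --> F] --> u 0 i.
Proof.
move=> fu; apply: (cvg_comp f (fun w : 'rV[R]_n => w 0 i)); first exact: fu.
exact: coord_continuous.
Qed.

Lemma cvg_dot (T : Type) (F : set_system T) {FF : Filter F}
    (f g : T -> 'rV[R]_n) u v :
  f @ F --> u -> g @ F --> v -> dot (f t) (g t) @[t --> F] --> dot u v.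
Proof.
move=> fu gv; apply: cvg_fsum => i.
by apply: cvgM; exact: cvg_coord.
Qed.

Lemma near_norm_lt x (e : R) : 0 < e -> \forall y \near x, `|y - x| < e.
Proof.
move=> e0; near=> y; rewrite distrC; near: y.
by apply: cvgr_dist_lt.
Unshelve. all: by end_near. Qed.

(** The Euclidean quotient in the definition is compared with the sup norm, in
    which the topology of row vectors is expressed; the factor [n.+1] between
    the two norms is absorbed by the arbitrary [e]. *)
Lemma regular_normalP C x v :
  regular_normal_cone C x v <->
  forall e, 0 < e -> \forall y \near x, C y -> dot v (y - x) <= e * `|y - x|.
Proof.
split=> [h e e0|h].
  have e'0 : 0 < e / n.+1%:R by rewrite divr_gt0.
  have : (limf_esup (fun y => (dot v (y - x) / enorm (y - x))%:E)
      (within C x^') < (e / n.+1%:R)%:E)%E.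
    by apply: le_lt_trans h _; rewrite lte_fin.
  move=> /ereal_inf_lt[_ [V FV <-]] sV.
  have {}FV : nbhs x [set y | y != x -> C y -> V y] by exact: FV.
  apply: filterS FV => y Vy Cy.
  have [->|yx] := eqVneq y x; first by rewrite subrr dotC dot0l normr0 mulr0.
  have yx0 : 0 < `|y - x| by rewrite normr_gt0 subr_eq0.
  have ey0 : 0 < enorm (y - x) by rewrite (lt_le_trans yx0)// norm_le_enorm.
  have : ((dot v (y - x) / enorm (y - x))%:E < (e / n.+1%:R)%:E)%E.
    by apply: le_lt_trans sV; apply: ereal_sup_ubound; exists y => //; exact: Vy.
  rewrite lte_fin ltr_pdivrMr// => /ltW/le_trans; apply.
  by rewrite -mulrA ler_wpM2l ?(ltW e0)// ler_pdivrMl// enorm_le_norm.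
apply/lee_addgt0Pr => e e0; rewrite add0e.
pose V := [set y : 'rV[R]_n | dot v (y - x) / enorm (y - x) <= e].
apply: (@le_trans _ _
  (ereal_sup ((fun y => (dot v (y - x) / enorm (y - x))%:E) @` V))).
  apply: ereal_inf_lbound; exists V => //.
  suff : nbhs x [set y | y != x -> C y -> V y] by [].
  apply: filterS (h e e0) => y hy yx Cy.
  have yx0 : 0 < `|y - x| by rewrite normr_gt0 subr_eq0.
  have ey0 : 0 < enorm (y - x) by rewrite (lt_le_trans yx0)// norm_le_enorm.
  rewrite /V /= ler_pdivrMr// (le_trans (hy Cy))// ler_wpM2l ?(ltW e0)//.
  exact: norm_le_enorm.
by apply: ge_ereal_sup => _ [y Vy <-]; rewrite lee_fin.
Qed.

(** Replaces the sequences in the definition by a condition on every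
    neighbourhood of [(x, v)], the form in which compactness arguments deliver
    normals. *)
Lemma normal_coneP C x v :
  normal_cone C x v <->
  forall e, 0 < e -> exists y w,
    [/\ C y, regular_normal_cone C y w, `|y - x| < e & `|w - v| < e].
Proof.
split=> [[xs [vs [Cxs xsx Nvs vsv]]] e e0|h].
  have : \forall k \near \oo, `|x - xs k| < e /\ `|v - vs k| < e.
    by apply: filterI; [move/cvgrPdist_lt : xsx | move/cvgrPdist_lt : vsv]; apply.
  move=> [k _ /(_ k (leqnn k))[? ?]]; exists (xs k), (vs k).
  by split => //; rewrite distrC.
have {}h (k : nat) : exists z : 'rV[R]_n * 'rV[R]_n,
    [/\ C z.1, regular_normal_cone C z.1 z.2, `|z.1 - x| < k.+1%:R^-1
      & `|z.2 - v| < k.+1%:R^-1].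
  by have [|y [w ?]] := h k.+1%:R^-1; [rewrite invr_gt0 | exists (y, w)].
have [z hz] := choice h; exists (fst \o z), (snd \o z).
split=> [k||k|]; try by have [] := hz k.
- apply/cvgrPdist_lt => e e0.
  near=> k; have [_ _ + _] := hz k; rewrite distrC => /lt_trans; apply.
  by near: k; exact: near_infty_natSinv_lt (PosNum e0).
- apply/cvgrPdist_lt => e e0.
  near=> k; have [_ _ _ +] := hz k; rewrite distrC => /lt_trans; apply.
  by near: k; exact: near_infty_natSinv_lt (PosNum e0).
Unshelve. all: by end_near. Qed.

Lemma regular_normal_normal C x v :
  C x -> regular_normal_cone C x v -> normal_cone C x v.
Proof.
by move=> Cx Nv; apply/normal_coneP => e e0; exists x, v; rewrite !subrr normr0.
Qed.

End Euclid.

(** * Compactness and penalization *)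

(** Stands in for the extraction of a convergent subsequence: a point of [K]
    that, as [e] tends to [0], is a cluster point of the solutions up to [e] of
    a problem. *)
Lemma compact_approx (R : realType) (T : topologicalType) (K : set T)
    (P : R -> set T) :
  compact K -> (forall e e', 0 < e -> e <= e' -> P e `<=` P e') ->
  (forall e, 0 < e -> K `&` P e !=set0) ->
  exists2 l, K l &
    forall e (U : set T), 0 < e -> nbhs l U -> exists x, [/\ K x, P e x & U x].
Proof.
move=> cK mP nP; pose F := filter_from [set e : R | 0 < e] (fun e => K `&` P e).
have PF : ProperFilter F.
  apply: filter_from_proper => //; apply: filter_from_filter.
    by exists 1; exact: ltr01.
  move=> e e' /= e0 e'0; exists (Num.min e e'); first by rewrite /= lt_min e0 e'0.
  have m0 : 0 < Num.min e e' by rewrite lt_min e0 e'0.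
  by move=> x [Kx Px]; split; split=> //; apply: mP Px => //;
    rewrite ge_min lexx ?orbT.
have FK : F K by exists 1 => /=; [exact: ltr01 | move=> x []].
have [l [Kl cl]] := cK F PF FK.
exists l => // e U e0 lU; have [|x [[Kx Px] Ux]] := cl (K `&` P e) U _ lU.
  by exists e.
by exists x.
Qed.

(** Comparing the minimizers [u] of [F + k * P] with [x0] bounds [k * P u]
    independently of [k], so [P] vanishes at their cluster points as [k] grows,
    and gives [F u <= F x0], which also passes to the limit. *)
Lemma penalty_approx (R : realType) (T : topologicalType) (K : set T) (x0 : T)
    (F P : T -> R) :
  compact K -> K x0 -> continuous F -> continuous P ->
  (forall x, 0 <= P x) -> P x0 = 0 ->
  exists l, [/\ K l, P l = 0, F l <= F x0 &
    forall U, nbhs l U -> exists k u, [/\ 0 < k, K u, U u &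
      forall y, K y -> F u + k * P u <= F y + k * P y]].
Proof.
move=> cK Kx0 cF cP P0 Px0.
pose Q (e : R) := [set u | exists k, [/\ e^-1 <= k, K u &
  forall y, K y -> F u + k * P u <= F y + k * P y]].
have [|e e0|l Kl hl] := @compact_approx R T K Q cK.
- move=> e e' e0 ee' u [k [ek Ku hu]]; exists k; split=> //.
  by apply: le_trans ek; rewrite lef_pV2 ?posrE// (lt_le_trans e0).
- have [||u uK hu] := @compact_EVT_min T R (fun u => F u + e^-1 * P u) K _ cK.
  + by exists x0.
  + apply: continuous_subspaceT => x; apply: cvgD; first exact: cF.
    by apply: cvgM; [exact: cvg_cst | exact: cP].
  + exists u; split; first exact: set_mem.
    exists e^-1; split=> //; first exact: set_mem.
    by move=> y Ky; apply: hu; rewrite inE.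
have Fu e u k : 0 < e -> e^-1 <= k ->
    (forall y, K y -> F u + k * P u <= F y + k * P y) ->
    F u + k * P u <= F x0.
  by move=> e0 ek /(_ x0 Kx0); rewrite Px0 mulr0 addr0.
have k_gt0 e k : 0 < e -> e^-1 <= k -> 0 < k :> R.
  by move=> e0; apply: lt_le_trans; rewrite invr_gt0.
exists l; split=> //.
- have [||m mK hm] := @compact_EVT_min T R F K _ cK.
  + by exists x0.
  + exact: continuous_subspaceT.
  apply/eqP; rewrite eq_le P0 andbT leNgt; apply/negP => Pl0.
  pose M := F x0 - F m.
  have M0 : 0 <= M by rewrite subr_ge0; apply: hm; rewrite inE.
  have Pl2 : P l / 2 < P l by rewrite ltr_pdivrMr// ltr_pMr// ltr1n.
  have e0 : 0 < P l / 2 / (M + 1) by rewrite !divr_gt0// ltr_wpDl.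
  have [u [Ku [k [ek _ hu]] Pu]] := hl _ [set y | P l / 2 < P y] e0
    (cvgr_gt (P l) (cP l) (P l / 2) Pl2).
  have := Fu _ _ _ e0 ek hu; have := hm u (mem_set Ku).
  suff : M + 1 <= k * P u by rewrite /M; lra.
  apply: (@le_trans _ _ ((P l / 2 / (M + 1))^-1 * (P l / 2))).
    by rewrite invf_div -mulrA mulVf ?mulr1// gt_eqF// divr_gt0.
  by apply: ler_pM => //; [rewrite invr_ge0 ltW | rewrite ltW// divr_gt0 | exact: ltW].
- rewrite leNgt; apply/negP => Fl.
  have [u [Ku [k [ek _ hu]] Fu']] := hl 1 [set y | F x0 < F y] ltr01
    (cvgr_gt (F l) (cF l) (F x0) Fl).
  have := Fu _ _ _ ltr01 ek hu.
  suff : 0 <= k * P u by move: Fu' => /=; lra.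
  by rewrite mulr_ge0// ltW// (k_gt0 1).
- move=> U lU; have [u [Ku [k [ek _ hu]] Uu]] := hl 1 U ltr01 lU.
  by exists k, u; split => //; exact: k_gt0 ek.
Qed.

(** * First-order expansions relative to a set *)

Section FirstOrder.
Context {R : realType} {n : nat}.
Implicit Types (u v w x y : 'rV[R]_n) (A C D : set 'rV[R]_n).
Implicit Types (f g : 'rV[R]_n -> R).

(** Differentiability relative to [A]: this is what [phi] satisfies on the face
    of its current zero pattern, although it is not differentiable across it.
    Off the directions of [A], the vector [v] is not determined. *)
Definition has_grad_on A f x v := forall e : R, 0 < e ->
  \forall y \near x, A y -> `|f y - f x - dot v (y - x)| <= e * `|y - x|.

Lemma differentiable_expansion (V : normedModType R) (f : V -> R) (x : V)
    (e : R) : differentiable f x -> 0 < e ->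
  \forall y \near x, `|f y - f x - 'd f x (y - x)| <= e * `|y - x|.
Proof.
move=> df e0.
have /eqaddoP/(_ e e0) := diff_locally df.
rewrite [X in _ -> X](near_shift 0) => h; rewrite subr0.
apply: filterS h => h /=.
by rewrite addrK !opprD !addrA.
Qed.

Lemma C1_has_grad A f x : C1 f -> has_grad_on A f x (grad f x).
Proof.
move=> [df _] e e0; apply: filterS (differentiable_expansion (df x) e0) => y.
suff -> : 'd f x (y - x) = dot (grad f x) (y - x) by [].
rewrite {1}[y - x]row_sum_delta linear_sum /=; apply: eq_bigr => i _.
by rewrite linearZ /= [grad f x 0 i]mxE deriveE// mulrC.
Qed.

Lemma C1_continuous f : C1 f -> continuous f.
Proof. by move=> [df _] x; exact: differentiable_continuous. Qed.

Lemma has_gradD A f g x u v : has_grad_on A f x u -> has_grad_on A g x v ->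
  has_grad_on A (fun y => f y + g y) x (u + v).
Proof.
move=> hf hg e e0; have e20 : 0 < e / 2 by rewrite divr_gt0.
apply: filterS2 (hf _ e20) (hg _ e20) => y + + Ay.
move=> /(_ Ay) h1 /(_ Ay) h2; rewrite dotDl.
rewrite (_ : _ - _ = (f y - f x - dot u (y - x)) + (g y - g x - dot v (y - x))).
  by apply: (le_trans (ler_normD _ _)); lra.
by ring.
Qed.

Lemma has_grad_cst A (c : R) x : has_grad_on A (fun=> c) x 0.
Proof.
move=> e e0; near=> y => _.
by rewrite dot0l !subrr normr0 mulr_ge0 // ltW.
Unshelve. all: by end_near.
Qed.

Lemma has_grad_sum A (J : finType) (P : pred J) (f : J -> 'rV[R]_n -> R) x
    (v : J -> 'rV[R]_n) :
  (forall j, P j -> has_grad_on A (f j) x (v j)) ->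
  has_grad_on A (fun y => \sum_(j | P j) f j y) x (\sum_(j | P j) v j).
Proof.
move=> h; elim: (index_enum J) => [|j r ih].
  by rewrite big_nil; under eq_fun do rewrite big_nil; exact: has_grad_cst.
rewrite big_cons; under eq_fun do rewrite big_cons.
by case: ifPn => // Pj; apply: has_gradD => //; exact: h.
Qed.

Lemma has_gradZ A f x v (c : R) : has_grad_on A f x v ->
  has_grad_on A (fun y => c * f y) x (c *: v).
Proof.
move=> h e e0; have e'0 : 0 < e / (`|c| + 1) by rewrite divr_gt0// ltr_wpDl.
apply: filterS (h _ e'0) => y + Ay; move=> /(_ Ay) h1.
rewrite dotZl -!mulrBr normrM.
apply: (@le_trans _ _ (`|c| * (e / (`|c| + 1) * `|y - x|))).
  by rewrite ler_wpM2l.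
rewrite mulrA ler_wpM2r// mulrCA ler_piMr ?(ltW e0)//.
by rewrite ler_pdivrMr ?ltr_wpDl// mul1r lerDl.
Qed.

Lemma has_grad_lipschitz A f x v : has_grad_on A f x v ->
  exists2 L : R, 0 < L & \forall y \near x, A y -> `|f y - f x| <= L * `|y - x|.
Proof.
move=> h; exists (n.+1%:R * `|v| + 1); first by rewrite ltr_wpDl// mulr_ge0.
apply: filterS (h 1 ltr01) => y + Ay; move=> /(_ Ay) h1.
rewrite -[f y - f x](subrK (dot v (y - x))) (le_trans (ler_normD _ _))//.
by rewrite mulrDl addrC lerD// norm_dot_le.
Qed.

Lemma has_grad_sqr A f x v (c : R) : has_grad_on A f x v ->
  has_grad_on A (fun y => (f y - c) ^+ 2) x ((2 * (f x - c)) *: v).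
Proof.
move=> h e e0; have [L L0 hL] := has_grad_lipschitz h.
have e1 : 0 < e / (4 * (`|f x - c| + 1)).
  by rewrite divr_gt0// mulr_gt0// ltr_wpDl.
have e2 : 0 < e / (2 * L ^+ 2) by rewrite divr_gt0// mulr_gt0// exprn_gt0.
near=> y => Ay.
have h1 : `|f y - f x - dot v (y - x)| <= e / (4 * (`|f x - c| + 1)) * `|y - x|.
  by move: Ay; near: y; exact: h.
have h2 : `|f y - f x| <= L * `|y - x| by move: Ay; near: y.
have h3 : `|y - x| <= e / (2 * L ^+ 2).
  by apply: ltW; near: y; exact: near_norm_lt.
rewrite dotZl (_ : _ - _ = 2 * (f x - c) * (f y - f x - dot v (y - x))
  + (f y - f x) ^+ 2); last by ring.
apply: (le_trans (ler_normD _ _)).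
have b1 : `|2 * (f x - c) * (f y - f x - dot v (y - x))| <= e / 2 * `|y - x|.
  rewrite normrM; apply: le_trans (ler_wpM2l _ h1) _ => //.
  rewrite normrM (ger0_norm (ler0n _ 2)).
  rewrite mulrA ler_wpM2r//.
  rewrite [X in X <= _](_ : _ = (e / 2) * (`|f x - c| / (`|f x - c| + 1))).
    rewrite ler_piMr ?divr_ge0 ?(ltW e0)// ler_pdivrMr ?ltr_wpDl//.
    by rewrite mul1r lerDl.
  by field; rewrite gt_eqF// ltr_wpDl.
have b2 : `|(f y - f x) ^+ 2| <= e / 2 * `|y - x|.
  rewrite normrX (@le_trans _ _ ((L * `|y - x|) ^+ 2))//.
    by rewrite ler_pXn2r ?nnegrE// mulr_ge0// ltW.
  rewrite exprMn [`|y - x| ^+ 2]expr2 mulrA ler_wpM2r//.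
  rewrite (_ : e / 2 = L ^+ 2 * (e / (2 * L ^+ 2))) ?ler_wpM2l ?sqr_ge0//.
  by field; rewrite gt_eqF.
lra.
Unshelve. all: by end_near. Qed.

Lemma has_grad_sqdist A a x :
  has_grad_on A (fun y => dot (y - a) (y - a)) x (2 *: (x - a)).
Proof.
move=> e e0; near=> y => _.
rewrite (_ : _ - _ = dot (y - x) (y - x)).
  rewrite ger0_norm ?dot_ge0// (le_trans (dot_le_norm_sqr _))//.
  rewrite expr2 mulrA ler_wpM2r// -ler_pdivlMl// mulrC ltW//.
  by near: y; apply: near_norm_lt; rewrite divr_gt0.
rewrite dotZl (_ : y - a = (y - x) + (x - a)); last by rewrite subrKA.
move: (y - x) (x - a) => z w; rewrite !dotDl !dotDr (dotC z w); ring.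
Unshelve. all: by end_near. Qed.

Lemma cvg_ray x (d : 'rV[R]_n) : x + t *: d @[t --> 0^'+] --> x.
Proof.
rewrite -[X in _ --> X](addr0 x); apply: cvgD; first exact: cvg_cst.
rewrite -[X in _ --> X](scale0r d); apply: cvgZr_tmp.
exact: cvg_at_right_filter.
Qed.

Lemma has_grad_descent A f x v d : has_grad_on A f x v ->
  (forall t, 0 < t -> A (x + t *: d)) -> dot v d < 0 ->
  \forall t \near 0^'+, f (x + t *: d) < f x.
Proof.
move=> h Ad vd.
have e0 : 0 < - dot v d / (2 * (`|d| + 1)).
  by rewrite divr_gt0// ?oppr_gt0// mulr_gt0// ltr_wpDl.
near=> t.
have t0 : 0 < t by near: t; exact: nbhs_right_gt.
have : `|f (x + t *: d) - f x - dot v (x + t *: d - x)| <=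
    - dot v d / (2 * (`|d| + 1)) * `|x + t *: d - x|.
  have : A (x + t *: d) by exact: Ad.
  by near: t; exact: (@cvg_ray x d _ (h _ e0)).
rewrite [x + _ - x]addrC addKr dotZr normrZ (gtr0_norm t0).
have -> : - dot v d / (2 * (`|d| + 1)) * (t * `|d|) =
    t * (- dot v d / 2) * (`|d| / (`|d| + 1)).
  by field; rewrite gt_eqF// ltr_wpDl.
move=> /(le_trans (ler_norm _)) h1.
have h2 : t * (- dot v d / 2) * (`|d| / (`|d| + 1)) <= t * (- dot v d / 2).
  rewrite ler_piMr// ?mulr_ge0 ?(ltW t0)//; first lra.
  by rewrite ler_pdivrMr ?ltr_wpDl// mul1r lerDl.
have h3 : t * dot v d < 0 by rewrite pmulr_rlt0.
lra.
Unshelve. all: by end_near. Qed.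

Lemma has_grad_fermat A f x v d : has_grad_on A f x v ->
  (forall t, 0 < t -> A (x + t *: d)) ->
  (\forall y \near x, A y -> f x <= f y) -> 0 <= dot v d.
Proof.
move=> h Ad hmin; rewrite leNgt; apply/negP => vd.
have h1 := has_grad_descent h Ad vd.
have h2 : \forall t \near 0^'+, A (x + t *: d) -> f x <= f (x + t *: d).
  exact: (@cvg_ray x d _ hmin).
have [t [[ft {}h2] t0]] : exists t, (f (x + t *: d) < f x /\
    (A (x + t *: d) -> f x <= f (x + t *: d))) /\ 0 < t.
  apply: (@filter_ex _ (0 : R)^'+); apply: filterI; first exact: filterI.
  exact: nbhs_right_gt.
by have := h2 (Ad _ t0); rewrite leNgt ft.
Qed.

(** Quadratic growth is the form in which the optimality of a squared distance
    produces regular normals. *)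
Lemma proximal_normal C x v (c : R) :
  (\forall y \near x, C y -> dot v (y - x) <= c * dot (y - x) (y - x)) ->
  regular_normal_cone C x v.
Proof.
move=> h; apply/regular_normalP => e e0; near=> y => Cy.
have h1 : dot v (y - x) <= c * dot (y - x) (y - x) by move: Cy; near: y.
apply: (le_trans h1); apply: (@le_trans _ _ (`|c| * (n.+1%:R * `|y - x| ^+ 2))).
  apply: (@le_trans _ _ (`|c| * dot (y - x) (y - x))).
    by rewrite ler_wpM2r ?dot_ge0// ler_norm.
  by rewrite ler_wpM2l// dot_le_norm_sqr.
rewrite expr2 !mulrA ler_wpM2r//.
apply: (@le_trans _ _ ((`|c| + 1) * n.+1%:R * `|y - x|)).
  by rewrite ler_wpM2r// ler_wpM2r// lerDl.
rewrite -ler_pdivlMl ?mulr_gt0 ?ltr_wpDl// mulrC ltW//.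
by near: y; apply: near_norm_lt; rewrite divr_gt0// mulr_gt0// ltr_wpDl.
Unshelve. all: by end_near. Qed.

End FirstOrder.

(** * Continuity, closed sets and compact balls *)

Lemma closed_sublevel (R : realType) (T : topologicalType) (h : T -> R) (r : R) :
  continuous h -> closed [set x | h x <= r].
Proof.
by move=> ch; apply: (preimage_closed (f := h) (D := [set t | t <= r]));
  [move=> x _; exact: ch | exact: closed_le].
Qed.

Lemma closed_level (R : realType) (T : topologicalType) (h : T -> R) (r : R) :
  continuous h -> closed [set x | h x = r].
Proof.
by move=> ch; apply: (preimage_closed (f := h) (D := [set t | t = r]));
  [move=> x _; exact: ch | exact: closed_eq].
Qed.

Lemma near_norm_ball (R : realType) (V : normedModType R) (x : V) (P : V -> Prop) :
  (\forall y \near x, P y) -> exists2 r : R, 0 < r & forall y, `|y - x| < r -> P y.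
Proof.
by move/nbhs_normP => [r /= r0 h]; exists r => // y yx; apply: h; rewrite /= distrC.
Qed.

Lemma cvg_subr_cst (R : realType) (V : normedModType R) (x a : V) :
  (y - a) @[y --> x] --> x - a.
Proof. by apply: cvgB; [exact: cvg_id | exact: cvg_cst]. Qed.

Lemma continuous_norm_subr (R : realType) (V : normedModType R) (a : V) :
  continuous (fun y => `|y - a|).
Proof. by move=> x; apply: cvg_norm; exact: cvg_subr_cst. Qed.

Lemma continuous_at_fsum (R : realType) (T : topologicalType) (J : finType)
    (f : J -> T -> R) (x : T) :
  (forall j, {for x, continuous (f j)}) ->
  {for x, continuous (fun t => \sum_j f j t)}.
Proof. exact: cvg_fsum. Qed.

Lemma continuous_at_mul (R : realType) (T : topologicalType) (f g : T -> R)
    (x : T) : {for x, continuous f} -> {for x, continuous g} ->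
  {for x, continuous (fun t => f t * g t)}.
Proof. exact: cvgM. Qed.

Lemma continuous_at_add (R : realType) (T : topologicalType) (f g : T -> R)
    (x : T) : {for x, continuous f} -> {for x, continuous g} ->
  {for x, continuous (fun t => f t + g t)}.
Proof. exact: cvgD. Qed.

Lemma near_fin_forall (T : topologicalType) (J : finType) (x : T)
    (Q : J -> T -> Prop) :
  (forall j, \forall y \near x, Q j y) -> \forall y \near x, forall j, Q j y.
Proof. exact: filter_forall. Qed.

Lemma continuous_sqdist (R : realType) (n : nat) (a : 'rV[R]_n) :
  continuous (fun y : 'rV[R]_n => dot (y - a) (y - a)).
Proof.
move=> x; have h : (fun y : 'rV[R]_n => y - a) @ x --> x - a by exact: cvg_subr_cst.
exact: (cvg_dot h h).
Qed.

Lemma compact_closed_ball_setI (R : realType) (n : nat) (C : set 'rV[R]_n)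
    (x : 'rV[R]_n) (r : R) :
  closed C -> compact (C `&` [set y | `|y - x| <= r]).
Proof.
move=> cC; apply: bounded_closed_compact.
  exists (`|x| + r); split; first exact: num_real.
  move=> M hM y [_ /= yr]; rewrite -[y](subrK x).
  by apply: (le_trans (ler_normD _ _)); lra.
apply: closedI => //.
exact (closed_sublevel (@continuous_norm_subr _ _ x)).
Qed.

(** * Fritz John conditions *)

Section FritzJohn.
Context {R : realType} {n : nat}.
Implicit Types (x y u : 'rV[R]_n) (N : pred 'I_n).

(** The conditions on [l] are closed and positively homogeneous, so [l] can be
    scaled to the unit sphere of the l1 norm, which is compact; the scaling is
    also why the error in the stationarity equation is measured relatively to
    the size of [l]. *)
Lemma multipliers_limit (T : finType) N (D : T -> 'rV[R]_n -> 'rV[R]_n)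
    (xb : 'rV[R]_n) (pos null : pred T) :
  (forall j i, N i -> (D j y 0 i) @[y --> xb] --> D j xb 0 i) ->
  (forall e : R, 0 < e -> exists u (l : T -> R),
    [/\ `|u - xb| < e, exists j, l j != 0, forall j, pos j -> 0 <= l j,
        forall j, null j -> l j = 0 &
        forall i, N i ->
          `|\sum_j l j * D j u 0 i| <= e * \sum_j `|l j|]) ->
  exists l : T -> R,
    [/\ exists j, l j != 0, forall j, pos j -> 0 <= l j,
        forall j, null j -> l j = 0 &
        forall i, N i -> \sum_j l j * D j xb 0 i = 0].
Proof.
move=> cD h.
pose c (L : 'rV[R]_#|T|) j := L 0 (enum_rank j).
have c_cont j : continuous (c ^~ j) by move=> L; exact: coord_continuous.
pose K := [set L | \sum_j `|c L j| = 1].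
pose P e := [set L | exists u, [/\ `|u - xb| < e, forall j, pos j -> 0 <= c L j,
        forall j, null j -> c L j = 0 &
        forall i, N i -> `|\sum_j c L j * D j u 0 i| <= e]].
have cK : compact K.
  apply: bounded_closed_compact.
    exists 1; split; first exact: num_real.
    move=> M hM L /= KL; apply: norm_le_coord; first lra.
    move=> k; apply: (le_trans _ (ltW hM)); rewrite -KL.
    rewrite (bigD1 (enum_val k))//= {1}/c enum_valK lerDl.
    exact: sumr_ge0.
  have cs : continuous (fun L => \sum_j `|c L j|).
    move=> L; apply: continuous_at_fsum => j.
    exact: (continuous_comp (c_cont j L) (@norm_continuous _ _ _)).
  exact (closed_level cs).
have [|e e0|L KL hL] := @compact_approx R _ K P cK.
- move=> e e' e0 ee' L [u [ux p1 p2 p3]]; exists u; split=> //.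
    exact: lt_le_trans ee'.
  by move=> i Ni; apply: le_trans ee'; exact: p3.
- have [u [l [ux [j0 lj0] l1 l2 l3]]] := h e e0.
  pose s := \sum_j `|l j|.
  have s0 : 0 < s.
    rewrite /s (bigD1 j0)//= ltr_pwDl ?normr_gt0//; exact: sumr_ge0.
  pose L : 'rV[R]_#|T| := \row_k (l (enum_val k) / s).
  have cL j : c L j = l j / s by rewrite /c mxE enum_rankK.
  exists L; split.
    rewrite /K /=; under eq_bigr do rewrite cL normrM normfV (gtr0_norm s0).
    by rewrite -mulr_suml divff// gt_eqF.
  exists u; split=> // [j pj|j nj|i Ni].
  + by rewrite cL divr_ge0 ?l1// ltW.
  + by rewrite cL l2// mul0r.
  + under eq_bigr do rewrite cL mulrAC.
    by rewrite -mulr_suml normrM normfV (gtr0_norm s0) ler_pdivrMr// l3.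
exists (c L); split.
- apply: contrapT => nj; move: KL; rewrite /K /= big1 => [/eqP|j _].
    by rewrite eq_sym oner_eq0.
  by apply/eqP; rewrite normr_eq0; apply/negP => /negP ?; apply: nj; exists j.
- move=> j pj; rewrite leNgt; apply/negP => Lj.
  have [M [_ [u [_ p1 _ _]] /= Mj]] := hL 1 [set M | c M j < 0] ltr01
    (cvgr_lt (c L j) (c_cont j L) 0 Lj).
  by have := p1 j pj; rewrite leNgt Mj.
- move=> j nj; apply/eqP; rewrite -normr_le0 leNgt; apply/negP => Lj.
  have [M [_ [u [_ _ p2 _]] /= Mj]] := hL 1 [set M | 0 < `|c M j|] ltr01
    (cvgr_norm_gt (c L j) (c_cont j L) 0 Lj).
  by move: Mj; rewrite p2// normr0 ltxx.
- move=> i Ni; apply/eqP; rewrite -normr_le0 leNgt; apply/negP => S0.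
  pose G (z : 'rV[R]_#|T| * 'rV[R]_n) := \sum_j c z.1 j * D j z.2 0 i.
  have cG : {for (L, xb), continuous G}.
    apply: continuous_at_fsum => j; apply: continuous_at_mul.
      by apply: (@continuous_comp _ _ _ fst (c ^~ j)); [exact: cvg_fst | exact: c_cont].
    by apply: (@continuous_comp _ _ _ snd (fun y => D j y 0 i));
      [exact: cvg_snd | exact: cD].
  have G2 : `|G (L, xb)| / 2 < `|G (L, xb)|.
    by rewrite ltr_pdivrMr// ltr_pMr// ltr1n.
  have [[U V] /= [LU xV] UV] := cvgr_norm_gt (G (L, xb)) cG _ G2.
  have [r r0 rV] := near_norm_ball xV.
  have e0 : 0 < Num.min r (`|G (L, xb)| / 2) by rewrite lt_min r0 divr_gt0.
  have [M [_ [u [ux _ _ p3]] UM]] := hL _ U e0 LU.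
  have := UV (M, u); rewrite /=; move: ux; rewrite lt_min => /andP[ur _].
  move=> /(_ (conj UM (rV _ ur))); rewrite ltNge => /negP; apply.
  by apply: (le_trans (p3 i Ni)); rewrite ge_min lexx orbT.
Qed.

(** The squared distance to [xb] added to [f0] turns the local minimizer into a
    strict one, so that the penalized minimizers tend to [xb]. At such a
    minimizer [u] the multiplier of [g j] is [2 * k] times its violation: it is
    nonnegative for an inequality, and zero as soon as [g j u < 0]. Only the
    coordinates in [N] are free, the others being frozen at those of [xb]. *)
Lemma fritz_john (T : finType) N (f0 : 'rV[R]_n -> R) (g : T -> 'rV[R]_n -> R)
    (ineq : pred T) (df0 : 'rV[R]_n -> 'rV[R]_n)
    (dg : T -> 'rV[R]_n -> 'rV[R]_n) (xb : 'rV[R]_n) :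
  let A := [set y : 'rV[R]_n | forall i, ~~ N i -> y 0 i = xb 0 i] in
  let feasible y := forall j, if ineq j then g j y <= 0 else g j y == 0 in
  continuous f0 -> (forall j, continuous (g j)) ->
  (\forall u \near xb, A u -> has_grad_on A f0 u (df0 u)) ->
  (forall j, \forall u \near xb, A u -> has_grad_on A (g j) u (dg j u)) ->
  (forall i, N i -> (df0 y 0 i) @[y --> xb] --> df0 xb 0 i) ->
  (forall j i, N i -> (dg j y 0 i) @[y --> xb] --> dg j xb 0 i) ->
  feasible xb ->
  (\forall y \near xb, A y -> feasible y -> f0 xb <= f0 y) ->
  exists (l0 : R) (l : T -> R),
    [/\ l0 != 0 \/ (exists j, l j != 0), 0 <= l0, forall j, ineq j -> 0 <= l j,
        forall j, ineq j -> g j xb < 0 -> l j = 0 &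
        forall i, N i ->
          l0 * df0 xb 0 i + \sum_j l j * dg j xb 0 i = 0].
Proof.
move=> A feasible cf0 cg hf0 hg cdf0 cdg fxb fmin.
(* [inl tt] indexes the objective, treated as one more multiplier *)
pose D (o : unit + T) := match o with inl _ => df0 | inr j => dg j end.
pose pos (o : unit + T) := if o is inr j then ineq j else true.
pose null (o : unit + T) := if o is inr j then ineq j && (g j xb < 0) else false.
have sumE (F : unit + T -> R) : \sum_o F o = F (inl tt) + \sum_j F (inr j).
  rewrite big_sumType/=; congr (_ + _).
  by rewrite (bigD1 tt)//= big1 ?addr0// => -[].
have Axb : A xb by [].
have [| |l [lo l1 l2 l3]] :=
    @multipliers_limit _ N D xb pos null; last first.
- exists (l (inl tt)), (l \o inr); split=> [||j ij|j ij gj|i Ni].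
  + by case: lo => -[u|j] lo; [left; case: u lo | right; exists j].
  + exact: l1.
  + by apply: l1.
  + by apply: l2; rewrite /null ij gj.
  + by have := l3 i Ni; rewrite sumE.
- move=> e e0.
  have : \forall y \near xb, [/\ A y -> has_grad_on A f0 y (df0 y),
      forall j, A y -> has_grad_on A (g j) y (dg j y),
      A y -> feasible y -> f0 xb <= f0 y &
      forall j, g j xb < 0 -> g j y < 0].
    have hneg j : \forall y \near xb, g j xb < 0 -> g j y < 0.
      have [gj|gj] := ltP (g j xb) 0; last by near=> y.
      by near=> y => _; near: y; exact: (cvgr_lt (g j xb) (cg j xb) 0 gj).
    have hdg' := near_fin_forall hg; have hneg' := near_fin_forall hneg.
    by near=> y; split; near: y.
  move=> /near_norm_ball[r r0 hr].
  have r2 : r / 2 < r by rewrite ltr_pdivrMr// ltr_pMr// ltr1n.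
  have r20 : 0 < r / 2 by rewrite divr_gt0.
  pose K := A `&` [set y | `|y - xb| <= r / 2].
  have cA : closed A.
    rewrite (_ : A = \bigcap_(i in [set i | ~~ N i]) [set y | y 0 i = xb 0 i]).
      apply: closed_bigI => i _; exact (closed_level (@coord_continuous R 1 n 0 i)).
    by apply/seteqP; split => y /= hy i; exact: hy.
  have cK : compact K by exact: compact_closed_ball_setI.
  pose viol j y := if ineq j then Num.max (g j y) 0 else g j y.
  pose F y := f0 y + dot (y - xb) (y - xb).
  pose P y := \sum_j viol j y ^+ 2.
  have cF : continuous F.
    by move=> y; exact: (continuous_at_add (cf0 y) (@continuous_sqdist _ _ xb y)).
  have cP : continuous P.
    rewrite /P => y; apply: continuous_at_fsum => j.
    suff cv : {for y, continuous (viol j)} by exact: (continuous_at_mul cv cv).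
    rewrite /viol; case: (ineq j); last exact: cg.
    by apply: continuous_max; [exact: cg | exact: cst_continuous].
  have P0 y : 0 <= P y by apply: sumr_ge0 => j _; exact: sqr_ge0.
  have viol0 y j : viol j y = 0 <-> if ineq j then g j y <= 0 else g j y == 0.
    rewrite /viol; case: (ineq j); last by split=> /eqP.
    split => [<-|/max_idPr//].
    by rewrite le_max lexx.
  have Pxb : P xb = 0.
    by rewrite /P big1// => j _; rewrite (viol0 xb j).2 ?expr0n//; exact: fxb.
  have Kxb : K xb by split=> //=; rewrite subrr normr0 ltW.
  have [x [[Ax xr] Px Fx hx]] := penalty_approx cK Kxb cF cP P0 Pxb.
  have xxb : x = xb.
    have [//|_ _ hmin _] := hr x; first exact: le_lt_trans r2.
    have fx : feasible x.
      move=> j; apply/viol0; apply/eqP; rewrite -sqrf_eq0; apply/eqP.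
      move/eqP: Px; rewrite /P psumr_eq0 => [/allP/(_ j (mem_index_enum _))|//].
        by move/eqP.
      by move=> ? _; exact: sqr_ge0.
    have d0 : dot (x - xb) (x - xb) <= 0.
      by have := hmin Ax fx; move: Fx; rewrite /F subrr dot0l; lra.
    apply/eqP; rewrite -subr_eq0 -normr_eq0 -sqrf_eq0 eq_le sqr_ge0 andbT.
    by apply: le_trans d0; exact: norm_sqr_le_dot.
  have m0 : 0 < Num.min (e / 2) (r / 2) by rewrite lt_min r20 divr_gt0.
  have [|k [u [k0 [Au _] /= uU hu]]] := hx [set y | `|y - xb| < Num.min (e / 2) (r / 2)].
    by rewrite xxb; exact: near_norm_lt.
  move: uU; rewrite lt_min => /andP[ue ur].
  have [|hf hgu _ hneg] := hr u; first exact: lt_trans r2.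
  (* [c j] makes [(g j - c j) ^+ 2] a smooth majorant of the squared violation
     that agrees with it at [u] *)
  pose c j := if ineq j then Num.min (g j u) 0 else 0.
  pose M y := F y + \sum_j k * (g j y - c j) ^+ 2.
  have Mu : M u = F u + k * P u.
    rewrite /M /P mulr_sumr; congr (_ + _); apply: eq_bigr => j _.
    rewrite /viol /c; case: (ineq j); last by rewrite subr0.
    by case: (leP (g j u) 0) => _; rewrite ?subrr ?subr0.
  have M_ge y : F y + k * P y <= M y.
    rewrite /M /P mulr_sumr lerD2l; apply: ler_sum => j _.
    rewrite ler_wpM2l ?(ltW k0)// /viol /c.
    case: (ineq j); last by rewrite subr0.
    have [gy|gy] := leP (g j y) 0; first by rewrite expr0n sqr_ge0.
    have m0' : Num.min (g j u) 0 <= 0 by rewrite ge_min lexx orbT.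
    by rewrite (ler_pXn2r (isT : (0 < 2)%N)) ?nnegrE; lra.
  have Mmin : \forall y \near u, A y -> M u <= M y.
    have ur0 : 0 < r / 2 - `|u - xb| by rewrite subr_gt0.
    near=> y => Ay; rewrite Mu; apply: le_trans (M_ge y); apply: hu; split=> //=.
    rewrite -(subrK u y) -addrA (le_trans (ler_normD _ _))//.
    rewrite -lerBrDr ltW//; near: y; exact: near_norm_lt.
  pose v := df0 u + 2 *: (u - xb) +
    \sum_j k *: ((2 * (g j u - c j)) *: dg j u).
  have hM : has_grad_on A M u v.
    apply: has_gradD; first by apply: has_gradD; [exact: hf | exact: has_grad_sqdist].
    by apply: has_grad_sum => j _; apply: has_gradZ; apply: has_grad_sqr; exact: hgu.
  have v0 i : N i -> v 0 i = 0.
    move=> Ni.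
    have Ad (s t : R) : A (u + t *: (s *: delta_mx 0 i)).
      move=> i' Ni'; rewrite !mxE /=.
      have -> : (i' == i) = false by apply/eqP => ii; rewrite ii Ni in Ni'.
      by rewrite !mulr0 addr0; exact: Au.
    have := has_grad_fermat hM (fun t _ => Ad 1 t) Mmin.
    have := has_grad_fermat hM (fun t _ => Ad (-1) t) Mmin.
    rewrite !dotZr !dot_delta; lra.
  (* The factor [e / 2] in the choice of [u] absorbs the gradient
     [2 *: (u - xb)] of the squared distance; the l1 norm of the multipliers is
     at least that of the objective, [1] *)
  exists u, (fun o => if o is inr j then k * (2 * (g j u - c j)) else 1).
  split=> [||[ [] |j]//= ij|[ [] |j]//= /andP[ij gj]|i Ni].
  + by apply: lt_trans ue _; rewrite ltr_pdivrMr// ltr_pMr// ltr1n.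
  + by exists (inl tt); exact: oner_neq0.
  + rewrite mulr_ge0 ?(ltW k0)// mulr_ge0// subr_ge0 /c ij.
    by rewrite ge_min lexx.
  + rewrite /c ij min_l; last by rewrite ltW// hneg.
    by rewrite subrr !mulr0.
  + rewrite !sumE /= normr1.
    have -> : 1 * df0 u 0 i + \sum_j k * (2 * (g j u - c j)) * dg j u 0 i =
        - (2 * (u - xb) 0 i).
      have := v0 i Ni; rewrite /v !mxE summxE => /eqP.
      rewrite addrAC addr_eq0 => /eqP <-; rewrite mul1r; congr (_ + _).
      by apply: eq_bigr => j _; rewrite !mxE mulrA.
    rewrite normrN normrM ger0_norm//.
    have h1 : `|(u - xb) 0 i| <= e / 2.
      by apply: le_trans (coord_le_norm _ _) _; exact: ltW.
    apply: (@le_trans _ _ e); first lra.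
    by rewrite ler_peMr ?(ltW e0)// lerDl sumr_ge0.
- by move=> [ [] |j] i Ni; [exact: cdf0 | exact: cdg].
Unshelve. all: by end_near. Qed.

End FritzJohn.

(** * Normals to an intersection *)

Section NormalSum.
Context {R : realType} {n : nat}.
Implicit Types (u v w x y z a b : 'rV[R]_n) (C D : set 'rV[R]_n).

Lemma near_norm_subr_le x y (r : R) : `|y - x| < r ->
  \forall y' \near y, `|y' - x| <= r.
Proof.
move=> yr; have h := @continuous_norm_subr R 'rV[R]_n x y.
by apply: filterS (cvgr_lt _ h r yr) => y' /ltW.
Qed.

Lemma regular_normalZ C x v (c : R) : 0 <= c ->
  regular_normal_cone C x v -> regular_normal_cone C x (c *: v).
Proof.
rewrite le_eqVlt => /predU1P[<- _|c0 /regular_normalP h].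
  apply: (@proximal_normal _ _ _ _ _ 0); near=> y => _.
  by rewrite scale0r dot0l mul0r.
apply/regular_normalP => e e0; apply: filterS (h (e / c) _) => [y + Cy|].
  by move=> /(_ Cy); rewrite dotZl mulrAC ler_pdivlMr// mulrC.
by rewrite divr_gt0.
Unshelve. all: by end_near. Qed.

Lemma regular_normalD_setI C D x a b :
  regular_normal_cone C x a -> regular_normal_cone D x b ->
  regular_normal_cone (C `&` D) x (a + b).
Proof.
move=> /regular_normalP ha /regular_normalP hb; apply/regular_normalP => e e0.
have e20 : 0 < e / 2 by rewrite divr_gt0.
apply: filterS2 (ha _ e20) (hb _ e20) => y + + [Cy Dy].
by move=> /(_ Cy) h1 /(_ Dy) h2; rewrite dotDl; lra.
Qed.

(** Project [x + t *: v] on the intersection, in penalized form: [y] in [C] and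
    [z] in [D] minimize the squared distance of [y] to [x + t *: v] plus [k]
    times the squared distance of [y] to [z]. Minimality in [y] and in [z]
    yields proximal normals to [C] and to [D] whose sum is
    [t^-1 *: (x + t *: v - y)]. As [v] is a regular normal, the limits of [y]
    are within a small multiple of [t] from [x], so that the sum is near [v]. *)
Lemma fuzzy_normal_setI C D x v (e : R) :
  closed C -> closed D -> C x -> D x -> regular_normal_cone (C `&` D) x v ->
  0 < e ->
  exists y z a b, [/\ C y /\ D z, regular_normal_cone C y a,
    regular_normal_cone D z b, `|y - x| < e /\ `|z - x| < e &
    `|a + b - v| < e].
Proof.
move=> cC cD Cx Dx /regular_normalP Nv e0.
pose e' := e / 8.
have e'0 : 0 < e' by rewrite divr_gt0.
have [rho rho0 hrho] := near_norm_ball (Nv e' e'0).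
pose r := Num.min rho e / 2.
have m0 : 0 < Num.min rho e by rewrite lt_min rho0.
have r0 : 0 < r by rewrite divr_gt0.
have r_min : r < Num.min rho e by rewrite ltr_pdivrMr// ltr_pMr// ltr1n.
have [r_rho r_e] : r < rho /\ r < e by move: r_min; rewrite lt_min => /andP.
(* With this step the bound [2 * t * e'] on the distance of the projection to
   [x] is [r / 2], inside the ball where the regularity of [v] is used *)
pose t := r / (4 * e').
have t0 : 0 < t by rewrite divr_gt0// mulr_gt0.
have te' : t * e' = r / 4 by rewrite /t; field; rewrite gt_eqF.
pose w := x + t *: v.
pose K := (C `&` [set y | `|y - x| <= r]) `*` (D `&` [set y | `|y - x| <= r]).
have cK : compact K by apply: compact_setX; exact: compact_closed_ball_setI.
pose F (q : 'rV[R]_n * 'rV[R]_n) := dot (q.1 - w) (q.1 - w).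
pose P (q : 'rV[R]_n * 'rV[R]_n) := dot (q.1 - q.2) (q.1 - q.2).
have cF : continuous F.
  move=> q; apply: (@continuous_comp _ _ _ fst (fun y => dot (y - w) (y - w))).
    exact: cvg_fst.
  exact: continuous_sqdist.
have cP : continuous P.
  move=> q; have h := @sub_continuous 'rV[R]_n q; exact: (cvg_dot h h).
have Kx : K (x, x) by rewrite /K /= subrr normr0 (ltW r0).
have Px : P (x, x) = 0 by rewrite /P subrr dot0l.
have [[ys zs] [[[Cy yr] [Dz _]] Pl Fl hl]] :=
  penalty_approx cK Kx cF cP (fun q => dot_ge0 _) Px.
rewrite /= in Cy yr Dz.
have dot0 u : dot u u = 0 -> u = 0.
  move=> u0; apply/eqP; rewrite -normr_eq0 -sqrf_eq0 eq_le sqr_ge0 andbT.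
  by rewrite -u0 norm_sqr_le_dot.
have zsE : zs = ys by apply/eqP; rewrite eq_sym -subr_eq0; apply/eqP; exact: dot0.
subst zs.
have ysx : `|ys - x| <= r / 2.
  have h1 : dot v (ys - x) <= e' * `|ys - x|.
    by apply: hrho => //; exact: le_lt_trans r_rho.
  have h2 := norm_sqr_le_dot (ys - x).
  move: Fl; rewrite /F /= (_ : x - w = - (t *: v)); last first.
    by rewrite /w opprD addrA subrr add0r.
  rewrite (_ : ys - w = (ys - x) - t *: v); last by rewrite /w opprD addrA.
  move: h1 h2; move: (ys - x) => h h1 h2.
  rewrite !(dotBl, dotBr, dotNl, dotNr, opprK) !(dotZl, dotZr) (dotC h v) => h3.
  have h4 : t * dot v h <= t * (e' * `|h|) by rewrite ler_wpM2l// ltW.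
  rewrite mulrA te' in h4.
  have [->|hn0] := eqVneq h 0; first by rewrite normr0 divr_ge0// ltW.
  rewrite -(@ler_pM2r _ `|h|) ?normr_gt0// -expr2; lra.
have [|k [[y z] [k0 [[Cy' yr'] [Dz' zr']] [/= Uy Uz] hyz]]] :=
    hl [set q | `|q.1 - ys| < r / 4 /\ `|q.2 - ys| < r / 4].
  have h : \forall y \near ys, `|y - ys| < r / 4.
    by apply: near_norm_lt; rewrite divr_gt0.
  by exists ([set y | `|y - ys| < r / 4], [set y | `|y - ys| < r / 4]).
rewrite /= in Cy' yr' Dz' zr'.
have near_x u : `|u - ys| < r / 4 -> `|u - x| < 3 / 4 * r.
  move=> uy; rewrite -(subrK ys u) -addrA (le_lt_trans (ler_normD _ _))//; lra.
have r34 : 3 / 4 * r < r by lra.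
have yx := near_x _ Uy; have zx := near_x _ Uz.
exists y, z, (t^-1 *: ((w - y) - k *: (y - z))), (t^-1 *: (k *: (y - z))).
split=> //.
- apply: (@proximal_normal _ _ _ _ _ (t^-1 * ((1 + k) / 2))).
  have := near_norm_subr_le (lt_trans yx r34); apply: filterS => y' y'r Cy1.
  have := hyz (y', z) (conj (conj Cy1 y'r) (conj Dz' zr')).
  rewrite /F /P /=.
  have -> : y' - w = (y - w) + (y' - y) by rewrite [RHS]addrC subrKA.
  have -> : y' - z = (y - z) + (y' - y) by rewrite [RHS]addrC subrKA.
  have -> : w - y = - (y - w) by rewrite opprB.
  move: (y - w) (y - z) (y' - y) => p q h.
  rewrite dotZl -mulrA ler_pM2l ?invr_gt0//.
  rewrite !(dotBl, dotDl, dotDr, dotNl, dotZl) (dotC h p) (dotC h q); lra.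
- apply: (@proximal_normal _ _ _ _ _ (t^-1 * (k / 2))).
  have := near_norm_subr_le (lt_trans zx r34); apply: filterS => z' z'r Dz1.
  have := hyz (y, z') (conj (conj Cy' yr') (conj Dz1 z'r)).
  rewrite /F /P /=.
  have -> : y - z' = (y - z) - (z' - z) by rewrite opprB subrKA.
  move: (y - w) (y - z) (z' - z) => p q h.
  rewrite dotZl -mulrA ler_pM2l ?invr_gt0//.
  rewrite !(dotBl, dotBr, dotZl) (dotC h q); lra.
- by split; [apply: lt_trans r_e; exact: lt_trans r34
    | apply: lt_trans r_e; exact: lt_trans r34].
- rewrite -scalerDr subrK /w (_ : _ - v = - (t^-1 *: (y - x))); last first.
    rewrite addrAC scalerDr scalerA mulVf ?gt_eqF// scale1r addrK.
    by rewrite -scalerN opprB.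
  rewrite normrN normrZ gtr0_norm ?invr_gt0// ltr_pdivrMl//.
  have te : t * e = 2 * r.
    have eE : e = 8 * e' by rewrite /e'; field.
    by rewrite {}eE mulrCA te'; lra.
  by apply: (lt_trans yx); rewrite te; lra.
Qed.

(** The fuzzy decompositions [a + b] of [v] converge if their terms [b] stay
    bounded. Otherwise [b / `|b|] has a cluster point [u] of norm [1], normal to
    [D], and since [a + b] is bounded, [- u] is normal to [C]: this is what the
    qualification excludes. *)
Lemma normal_cone_setI_sub C D x v : closed C -> closed D ->
  (forall u, normal_cone C x u -> normal_cone D x (- u) -> u = 0) ->
  normal_cone (C `&` D) x v ->
  exists a b, [/\ normal_cone C x a, normal_cone D x b & v = a + b].
Proof.
move=> cC cD CQ /normal_coneP Nv.
pose Q (e : R) b := exists y z a,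
  [/\ [/\ C y, D z, `|y - x| < e & `|z - x| < e], regular_normal_cone C y a,
      regular_normal_cone D z b & `|a + b - v| < e].
have Qmono e e' : e <= e' -> Q e `<=` Q e'.
  move=> ee' b [y [z [a [[Cy Dz yx zx] Na Nb ab]]]]; exists y, z, a.
  by split=> //; [split=> // |]; exact: lt_le_trans ee'.
have Qex e : 0 < e -> exists b, Q e b.
  move=> e0; have e20 : 0 < e / 2 by rewrite divr_gt0.
  have [x' [v' [[Cx' Dx'] Nv' xx' vv']]] := Nv _ e20.
  have [y [z [a [b [[Cy Dz] Na Nb [yx zx] ab]]]]] :=
    fuzzy_normal_setI cC cD Cx' Dx' Nv' e20.
  have tri (p q s : 'rV[R]_n) :
      `|p - q| < e / 2 -> `|q - s| < e / 2 -> `|p - s| < e.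
    move=> pq qs; rewrite -(subrK q p) -addrA (le_lt_trans (ler_normD _ _))//.
    lra.
  exists b, y, z, a; split=> //; first split=> //.
  - exact: tri yx xx'.
  - exact: tri zx xx'.
  - exact: tri ab vv'.
have [[M hM]|/forallNP unb] :=
    pselect (exists M, forall e, 0 < e -> exists b, `|b| <= M /\ Q e b).
  have cK := @compact_closed_ball_setI R n setT 0 M closedT.
  have [|e e0|b _ hb] := @compact_approx R _ _ Q cK.
  - by move=> e e' _; exact: Qmono.
  - have [b [bM Qb]] := hM e e0; exists b; split=> //; split=> //=.
    by rewrite subr0.
  exists (v - b), b; split; last by rewrite subrK.
  - apply/normal_coneP => e e0; have e20 : 0 < e / 2 by rewrite divr_gt0.
    have [b' [_ [y [z [a [[Cy Dz yx zx] Na Nb ab]]]] bb']] :=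
      hb _ [set b' | `|b' - b| < e / 2] e20 (near_norm_lt b e20).
    exists y, a; split=> //; first by apply: (lt_trans yx); lra.
    rewrite (_ : _ - _ = (a + b' - v) - (b' - b)).
      by rewrite (le_lt_trans (ler_normB _ _))//; move: bb' => /=; lra.
    by apply/rowP => i; rewrite !mxE; ring.
  - apply/normal_coneP => e e0.
    have [b' [_ [y [z [a [[Cy Dz yx zx] Na Nb ab]]]] bb']] :=
      hb _ [set b' | `|b' - b| < e] e0 (near_norm_lt b e0).
    by exists z, b'.
pose Q' (e : R) u := exists y z a,
  [/\ [/\ C y, D z, `|y - x| < e & `|z - x| < e], regular_normal_cone C y a,
      regular_normal_cone D z u & `|a + u| < e].
pose S := [set u : 'rV[R]_n | `|u| = 1].
have cS : closed S.
  exact (closed_level (@norm_continuous R 'rV[R]_n)).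
have cK := @compact_closed_ball_setI R n S 0 1 cS.
have [|e e0|u [Su _] hu] := @compact_approx R _ _ Q' cK.
- move=> e e' _ ee' b [y [z [a [[Cy Dz yx zx] Na Nb ab]]]]; exists y, z, a.
  by split=> //; [split=> // |]; exact: lt_le_trans ee'.
- (* [`|a + b| < `|v| + e], so [`|b| > M] makes [(a + b) / `|b|] smaller
     than [e] *)
  pose M := (`|v| + e) / e.
  have /existsNP[e1 /not_implyP[e10 /forallNP hM]] := unb M.
  have m0 : 0 < Num.min e e1 by rewrite lt_min e0.
  have [b Qb] := Qex _ m0.
  have bM : M < `|b|.
    rewrite ltNge; apply/negP => bM; apply: (hM b); split=> //.
    by apply: Qmono Qb; rewrite ge_min lexx orbT.
  have M0 : 0 < M by rewrite divr_gt0// ltr_wpDl.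
  have b0 : 0 < `|b| by exact: lt_trans bM.
  have Sb : `| `|b|^-1 *: b | = 1.
    by rewrite normrZ gtr0_norm ?invr_gt0// mulVf// gt_eqF.
  exists (`|b|^-1 *: b); split; first by split=> //=; rewrite subr0 Sb.
  have [y [z [a [[Cy Dz yx zx] Na Nb ab]]]] : Q e b.
    by apply: Qmono Qb; rewrite ge_min lexx.
  exists y, z, (`|b|^-1 *: a); split; first by split.
  + by apply: regular_normalZ => //; rewrite invr_ge0 ltW.
  + by apply: regular_normalZ => //; rewrite invr_ge0 ltW.
  + rewrite -scalerDr normrZ gtr0_norm ?invr_gt0// ltr_pdivrMl//.
    apply: (@lt_trans _ _ (`|v| + e)).
      by rewrite -(subrK v (a + b)) (le_lt_trans (ler_normD _ _))// addrC ltrD2l.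
    by move: bM; rewrite /M ltr_pdivrMr.
have Nu : normal_cone D x (- - u).
  rewrite opprK; apply/normal_coneP => e e0.
  have [u' [_ [y [z [a [[Cy Dz yx zx] Na Nb ab]]]] uu']] :=
    hu _ [set u' | `|u' - u| < e] e0 (near_norm_lt u e0).
  by exists z, u'.
have NCu : normal_cone C x (- u).
  apply/normal_coneP => e e0; have e20 : 0 < e / 2 by rewrite divr_gt0.
  have [u' [_ [y [z [a [[Cy Dz yx zx] Na Nb ab]]]] uu']] :=
    hu _ [set u' | `|u' - u| < e / 2] e20 (near_norm_lt u e20).
  exists y, a; split=> //; first by apply: (lt_trans yx); lra.
  rewrite opprK (_ : a + u = (a + u') - (u' - u)).
    by rewrite (le_lt_trans (ler_normB _ _))//; move: uu' => /=; lra.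
  by apply/rowP => i; rewrite !mxE; ring.
by have := CQ _ NCu Nu; move: Su => /[swap] /eqP; rewrite oppr_eq0 => /eqP ->;
  rewrite /S /= normr0 => /eqP; rewrite eq_sym oner_eq0.
Qed.

Lemma normal_cone_setI C D x : closed C -> closed D -> C x -> D x ->
  normal_cone C x `<=` regular_normal_cone C x ->
  normal_cone D x `<=` regular_normal_cone D x ->
  (forall u, normal_cone C x u -> normal_cone D x (- u) -> u = 0) ->
  normal_cone (C `&` D) x =
    [set a + b | a in normal_cone C x & b in normal_cone D x].
Proof.
move=> cC cD Cx Dx rC rD CQ; apply/seteqP; split=> [v Nv|_ [a Na [b Nb <-]]].
  have [a [b [Na Nb ->]]] := normal_cone_setI_sub cC cD CQ Nv.
  by exists a => //; exists b.
apply: regular_normal_normal => //.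
by apply: regular_normalD_setI; [exact: rC | exact: rD].
Qed.

Lemma regular_normal_ray C x v d : regular_normal_cone C x v ->
  (\forall t \near (0 : R)^'+, C (x + t *: d)) -> dot v d <= 0.
Proof.
move=> /regular_normalP Nv Cd.
have h e : 0 < e -> dot v d <= e * `|d|.
  move=> e0.
  have h1 : \forall t \near 0^'+, C (x + t *: d) ->
      dot v (x + t *: d - x) <= e * `|x + t *: d - x|.
    exact: (@cvg_ray _ _ x d _ (Nv _ e0)).
  have [t [[{}h1 Ct] t0]] : exists t : R, ((C (x + t *: d) ->
      dot v (x + t *: d - x) <= e * `|x + t *: d - x|) /\ C (x + t *: d)) /\
      0 < t.
    apply: (@filter_ex _ (0 : R)^'+); apply: filterI; first exact: filterI.
    exact: nbhs_right_gt.
  have := h1 Ct; rewrite [x + _ - x]addrC addKr dotZr normrZ (gtr0_norm t0).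
  by rewrite mulrCA ler_pM2l.
apply/ler_addgt0Pr => e e0; rewrite add0r.
have e1 : 0 < e / (`|d| + 1) by rewrite divr_gt0// ltr_wpDl.
apply: (le_trans (h _ e1)).
by rewrite mulrAC ler_pdivrMr ?ltr_wpDl// ler_pM2l// lerDl.
Qed.

Definition convex_segments C := forall x y (t : R), 0 <= t <= 1 ->
  C x -> C y -> C (x + t *: (y - x)).

Lemma convex_regular_normal C x y v : convex_segments C -> C x -> C y ->
  regular_normal_cone C x v -> dot v (y - x) <= 0.
Proof.
move=> cC Cx Cy Nv; apply: (regular_normal_ray Nv); near=> t.
by apply: cC => //; apply/andP; split; near: t;
  [exact: nbhs_right_ge | exact: nbhs_right_le].
Unshelve. all: by end_near. Qed.

(** For a convex set, regular normals satisfy the global inequality of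
    [convex_regular_normal], which is preserved by limits of the base point and
    of the normal. *)
Lemma convex_normal_regular C x : convex_segments C -> C x ->
  normal_cone C x `<=` regular_normal_cone C x.
Proof.
move=> cC Cx v [xs [vs [Cxs xsx Nvs vsv]]].
apply: (@proximal_normal _ _ _ _ _ 0); near=> y => Cy.
rewrite mul0r leNgt; apply/negP => vy.
have yxs : (y - xs k) @[k --> \oo] --> y - x.
  by apply: cvgB => //; exact: cvg_cst.
have [k _ /(_ k (leqnn k)) /=] := cvgr_gt _ (cvg_dot vsv yxs) 0 vy.
by rewrite ltNge (convex_regular_normal cC (Cxs k) Cy (Nvs k)).
Unshelve. all: by end_near. Qed.

End NormalSum.

(** * The power sum and its sublevel sets *)

Section PowerSum.
Context {R : realType}.
Implicit Types (p s e : R).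

Lemma is_derive_differentiable (f : R -> R) (a df : R) :
  is_derive a 1 f df -> differentiable f a /\ forall h, 'd f a h = df * h.
Proof.
move=> fa; have fd : differentiable f a.
  by apply/derivable1_diffP; exact: ex_derive.
split=> // h; rewrite -[h in 'd f a h]mulr1 -[h * 1]/(h *: 1) linearZ /=.
by rewrite -deriveE// derive_val mulrC.
Qed.

Lemma norm_powR_expansion p s0 e : s0 != 0 -> 0 < e -> \forall s \near s0,
  `| `|s| `^ p - `|s0| `^ p - p * Num.sg s0 * `|s0| `^ (p - 1) * (s - s0)|
    <= e * `|s - s0|.
Proof.
move=> s00 e0; have a0 : 0 < `|s0| by rewrite normr_gt0.
have [df dfE] := is_derive_differentiable (is_derive1_powR p a0).
have nc := @norm_continuous R R s0.
have h : \forall s \near s0, `| `|s| `^ p - `|s0| `^ p -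
    p * `|s0| `^ (p - 1) * (`|s| - `|s0|)| <= e * `| `|s| - `|s0| |.
  near=> s; rewrite -dfE; near: s.
  exact: (nc _ (differentiable_expansion df e0)).
have sg_near : \forall s \near s0, Num.sg s0 * (s - s0) = `|s| - `|s0|.
  have [s0p|s0n|s0z] := ltrgtP 0 s0; last by rewrite -s0z eqxx in s00.
  - near=> s; have sp : 0 < s by near: s; exact: lt_nbhsr.
    by rewrite !gtr0_norm// gtr0_sg// mul1r.
  - near=> s; have sn : s < 0 by near: s; exact: lt_nbhsl.
    by rewrite !ltr0_norm// ltr0_sg//; ring.
near=> s.
have sgE : Num.sg s0 * (s - s0) = `|s| - `|s0| by near: s.
have hs : `| `|s| `^ p - `|s0| `^ p - p * `|s0| `^ (p - 1) * (`|s| - `|s0|)|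
    <= e * `| `|s| - `|s0| | by near: s.
rewrite -sgE in hs.
have -> : p * Num.sg s0 * `|s0| `^ (p - 1) * (s - s0) =
  p * `|s0| `^ (p - 1) * (Num.sg s0 * (s - s0)) by ring.
by apply: (le_trans hs); rewrite normrM normr_sg s00 mul1r.
Unshelve. all: by end_near. Qed.

Lemma continuous_norm_powR p : 0 < p -> continuous (fun s : R => `|s| `^ p).
Proof.
move=> p0 s; have [->|s0] := eqVneq s 0.
  apply/cvgrPdist_lt => e e0.
  have h : \forall t \near (0 : R), `|t| < e `^ p^-1.
    by apply: nbhs0_lt; exact: powR_gt0.
  near=> t; rewrite normr0 powR0 ?gt_eqF// sub0r normrN ger0_norm ?powR_ge0//.
  have -> : e = (e `^ p^-1) `^ p.
    by rewrite -powRrM mulVf ?gt_eqF// powRr1// ltW.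
  apply: gt0_ltr_powR => //; rewrite ?nnegrE ?powR_ge0//.
  by near: t; exact: h.
have a0 : 0 < `|s| by rewrite normr_gt0.
have [df _] := is_derive_differentiable (is_derive1_powR p a0).
exact: (@continuous_comp R R R (fun t => `|t|) (fun t => t `^ p) s
  (@norm_continuous R R s) (differentiable_continuous df)).
Unshelve. all: by end_near. Qed.

End PowerSum.

Section Phi.
Context {R : realType} {n : nat}.
Context (p : R) (p_gt0 : 0 < p).
Implicit Types (x y u v d : 'rV[R]_n) (A : set 'rV[R]_n) (N : pred 'I_n).

Lemma phi_continuous : continuous (phi p : 'rV[R]_n -> R).
Proof.
move=> x; apply: continuous_at_fsum => i.
apply: (@continuous_comp _ _ _ (fun y : 'rV[R]_n => y 0 i)
  (fun s => `|s| `^ p)); first exact: coord_continuous.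
exact: continuous_norm_powR.
Qed.

Lemma dphi_continuous x i : x 0 i != 0 ->
  {for x, continuous (fun y => dphi p y i)}.
Proof.
move=> xi; have a0 : 0 < `|x 0 i| by rewrite normr_gt0.
have [df _] := is_derive_differentiable (is_derive1_powR (p - 1) a0).
apply: (@continuous_comp _ _ _ (fun y : 'rV[R]_n => y 0 i)
  (fun s => p * Num.sg s * `|s| `^ (p - 1))); first exact: coord_continuous.
apply: continuous_at_mul; last first.
  exact: (@continuous_comp R R R (fun t => `|t|) (fun t => t `^ (p - 1))
    (x 0 i) (@norm_continuous R R _) (differentiable_continuous df)).
apply: continuous_at_mul; first exact: cst_continuous.
apply: cvg_near_cst.
have [xp|xn|xz] := ltrgtP 0 (x 0 i); last by rewrite -xz eqxx in xi.
- near=> s; have sp : 0 < s by near: s; exact: lt_nbhsr.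
  by rewrite !gtr0_sg.
- near=> s; have sn : s < 0 by near: s; exact: lt_nbhsl.
  by rewrite !ltr0_sg.
Unshelve. all: by end_near. Qed.

Lemma dphi_neq0 x i : x 0 i != 0 -> dphi p x i != 0.
Proof.
move=> xi; rewrite /dphi !mulf_eq0 sgr_eq0 powR_eq0 normr_eq0 (negbTE xi).
by rewrite !orbF gt_eqF.
Qed.

(** The gradient of [phi] along the face of the points that vanish off [N]. The
    other entries are set to [0], as [dphi] is not a derivative there. *)
Definition face_grad N x : 'rV[R]_n := \row_i (if N i then dphi p x i else 0).

Lemma has_grad_partial_phi A N x : (forall i, N i -> x 0 i != 0) ->
  has_grad_on A (fun y => \sum_(i | N i) `|y 0 i| `^ p) x (face_grad N x).
Proof.
move=> Nx.
have -> : face_grad N x = \sum_(i | N i) dphi p x i *: delta_mx 0 i.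
  rewrite [LHS]row_sum_delta [RHS]big_mkcond; apply: eq_bigr => i _.
  by rewrite mxE; case: ifP => // _; rewrite scale0r.
apply: has_grad_sum => i Ni e e0.
have h : \forall y \near x, `| `|(y : 'rV[R]_n) 0 i| `^ p - `|x 0 i| `^ p -
    dphi p x i * (y 0 i - x 0 i)| <= e * `|y 0 i - x 0 i|.
  exact: (@coord_continuous R 1 n 0 i x _ (norm_powR_expansion p (Nx i Ni) e0)).
apply: filterS h => y h _.
rewrite dotC dotZr dot_delta !mxE; apply: (le_trans h); rewrite ler_pM2l//.
by have := coord_le_norm (y - x) i; rewrite !mxE.
Qed.

Lemma phi_split N y :
  phi p y = \sum_(i | N i) `|y 0 i| `^ p + \sum_(i | ~~ N i) `|y 0 i| `^ p.
Proof. by rewrite /phi (bigID N). Qed.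

Lemma phi_face N y : (forall i, ~~ N i -> y 0 i = 0) ->
  phi p y = \sum_(i | N i) `|y 0 i| `^ p.
Proof.
move=> yN; rewrite (phi_split N) [X in _ + X]big1 ?addr0// => i Ni.
by rewrite yN// normr0 powR0// gt_eqF.
Qed.

Lemma has_grad_phi A N x : A x ->
  (forall i, N i -> x 0 i != 0) ->
  (forall y, A y -> forall i, ~~ N i -> y 0 i = 0) ->
  has_grad_on A (phi p) x (face_grad N x).
Proof.
move=> Ax Nx AN e e0; apply: filterS (@has_grad_partial_phi A N x Nx e e0).
move=> y + Ay; move=> /(_ Ay).
by rewrite !(@phi_face N); first exact; exact: AN.
Qed.

(** Farkas' lemma for one inequality, proved by splitting the restriction [v']
    of [v] to [N] into a multiple of [g] and a vector [w] orthogonal to [g]: the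
    test vectors [w - s *: g] with small [s] force [w = 0]. *)
Lemma normal_ray_of_halfspace N (g v : 'rV[R]_n) :
  (forall i, ~~ N i -> g 0 i = 0) -> g != 0 ->
  (forall d, (forall i, ~~ N i -> d 0 i = 0) -> dot g d < 0 -> dot v d <= 0) ->
  exists2 y0 : R, 0 <= y0 & forall i, N i -> v 0 i = y0 * g 0 i.
Proof.
move=> gN g0 h.
pose v' : 'rV[R]_n := \row_i (if N i then v 0 i else 0).
have v'N i : ~~ N i -> v' 0 i = 0 by rewrite mxE => /negbTE ->.
have vv' d : (forall i, ~~ N i -> d 0 i = 0) -> dot v d = dot v' d.
  move=> dN; apply: eq_bigr => i _; rewrite mxE; case: ifPn => // /dN ->.
  by rewrite !mulr0.
have gg0 : 0 < dot g g.
  by apply: lt_le_trans (norm_sqr_le_dot g); rewrite exprn_gt0// normr_gt0.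
pose y0 := dot v' g / dot g g.
have y0_ge0 : 0 <= y0.
  rewrite divr_ge0 ?dot_ge0//.
  have : dot v (- g) <= 0.
    apply: h => [i /gN gi|]; first by rewrite mxE gi oppr0.
    by rewrite dotNr oppr_lt0.
  by rewrite dotNr oppr_le0 vv'.
exists y0 => // i Ni.
pose w := v' - y0 *: g.
have gw : dot g w = 0.
  by rewrite dotBr dotZr (dotC g v') /y0 divfK ?subrr// gt_eqF.
have v'E : v' = w + y0 *: g by rewrite subrK.
have ww s : 0 < s -> dot w w <= s * dot v' g.
  move=> s0; have : dot v (w - s *: g) <= 0.
    apply: h => [j jN|]; first by rewrite !mxE gN// (negbTE jN) !mulr0 !subr0.
    by rewrite dotBr gw dotZr sub0r oppr_lt0 mulr_gt0.
  rewrite vv' => [|j jN]; last by rewrite !mxE gN// (negbTE jN) !mulr0 !subr0.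
  rewrite dotBr dotZr {1}v'E dotDl dotZl gw mulr0 addr0; lra.
have w0 : w = 0.
  apply/eqP; rewrite -normr_eq0 -sqrf_eq0 eq_le sqr_ge0 andbT.
  apply: (le_trans (norm_sqr_le_dot w)); apply/ler_addgt0Pr => e e0.
  rewrite add0r; have v'g : 0 <= dot v' g.
    by move: y0_ge0; rewrite pmulr_lge0// invr_gt0.
  have s0 : 0 < e / (dot v' g + 1) by rewrite divr_gt0// ltr_wpDl.
  apply: (le_trans (ww _ s0)); rewrite mulrAC ler_pdivrMr ?ltr_wpDl//.
  by rewrite ler_pM2l// lerDl.
have := congr1 (fun M : 'rV[R]_n => M 0 i) w0; rewrite !mxE Ni => /eqP.
by rewrite subr_eq0 => /eqP.
Qed.

(** The directions of the face of [x] along which [phi] decreases lead into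
    [Theta], whether the constraint is active at [x] or not; a regular normal is
    nonpositive on them. *)
Lemma Theta_regular_normal theta x v : Theta p theta x ->
  regular_normal_cone (Theta p theta) x v ->
  exists2 y0 : R, 0 <= y0 &
    forall i, i \in nonzeros x -> v 0 i = y0 * dphi p x i.
Proof.
move=> Tx Nv; pose N : pred 'I_n := fun i => x 0 i != 0.
have [/eqP g0|g0] := eqVneq (face_grad N x) 0.
  exists 0 => // i; rewrite inE => xi.
  have := congr1 (fun M : 'rV[R]_n => M 0 i) (eqP g0); rewrite !mxE /N xi.
  by move/eqP; rewrite (negbTE (dphi_neq0 xi)).
have [|||y0 y00 vE] := @normal_ray_of_halfspace N (face_grad N x) v => //.
- by move=> i /negbTE Ni; rewrite mxE Ni.
- move=> d dN gd; apply: (regular_normal_ray Nv).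
  pose A := [set y : 'rV[R]_n | forall i, ~~ N i -> y 0 i = 0].
  have xN i : ~~ N i -> x 0 i = 0 by rewrite /N negbK => /eqP.
  have gA : has_grad_on A (phi p) x (face_grad N x) by exact: has_grad_phi.
  have Ad t : 0 < t -> A (x + t *: d).
    by move=> _ i iN; rewrite !mxE xN// dN// mulr0 addr0.
  apply: filterS (has_grad_descent gA Ad gd) => t /ltW h.
  exact: le_trans h Tx.
- by exists y0 => // i; rewrite inE => xi; rewrite vE// mxE /N xi.
Qed.

(** Near [x] the coordinates in [nonzeros x] stay nonzero, so the preceding
    description applies to them at the approximating points. It is passed to
    the limit in the form of closed relations: proportionality to [dphi] through
    products of two entries, and the sign of [v 0 i0 * dphi p x i0] for one
    nonzero coordinate [i0], which exists as [x != 0]. *)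
Lemma Theta_normal theta x v : x != 0 -> normal_cone (Theta p theta) x v ->
  exists2 y0 : R, 0 <= y0 &
    forall i, i \in nonzeros x -> v 0 i = y0 * dphi p x i.
Proof.
move=> x0 [xs [vs [Txs xsx Nvs vsv]]].
have [i0 xi0] : exists i, x 0 i != 0.
  apply: contrapT => /forallNP h; case/negP: x0; apply/eqP/rowP => i.
  by rewrite mxE; apply/eqP; apply: contrapT => /negP; exact: h.
have nz_near i : x 0 i != 0 -> \forall k \near \oo, xs k 0 i != 0.
  by move=> xi; exact: (cvgr_neq0 (x 0 i) (cvg_coord (i := i) xsx) xi).
have cvs i : (vs k 0 i) @[k --> \oo] --> v 0 i by exact: cvg_coord.
have cds i : x 0 i != 0 -> dphi p (xs k) i @[k --> \oo] --> dphi p x i.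
  by move=> xi; apply: (cvg_comp xs (fun y => dphi p y i) xsx);
    exact: dphi_continuous.
have vsE k := Theta_regular_normal (Txs k) (Nvs k).
have D0 := dphi_neq0 xi0.
have y00 : 0 <= v 0 i0 * dphi p x i0.
  rewrite leNgt; apply/negP => neg.
  have hk : \forall k \near \oo,
      vs k 0 i0 * dphi p (xs k) i0 < 0 /\ xs k 0 i0 != 0.
    apply: filterI; last exact: nz_near.
    exact: (cvgr_lt _ (cvgM (cvs i0) (cds i0 xi0)) 0 neg).
  have [k [k1 k2]] := filter_ex hk.
  have [y y0 vy] := vsE k; move: k1; rewrite vy ?inE// -mulrA -expr2.
  by rewrite ltNge mulr_ge0// sqr_ge0.
exists (v 0 i0 / dphi p x i0).
  rewrite (_ : _ / _ = v 0 i0 * dphi p x i0 / dphi p x i0 ^+ 2).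
    by rewrite divr_ge0 ?sqr_ge0.
  by field.
move=> i; rewrite inE => xi.
have rel : v 0 i * dphi p x i0 - v 0 i0 * dphi p x i = 0.
  apply/eqP; apply: contrapT => /negP rel.
  have hG : (vs k 0 i * dphi p (xs k) i0 - vs k 0 i0 * dphi p (xs k) i)
      @[k --> \oo] --> v 0 i * dphi p x i0 - v 0 i0 * dphi p x i.
    exact: (cvgB (cvgM (cvs i) (cds i0 xi0)) (cvgM (cvs i0) (cds i xi))).
  have hk : \forall k \near \oo, vs k 0 i * dphi p (xs k) i0
      - vs k 0 i0 * dphi p (xs k) i != 0 /\ xs k 0 i0 != 0 /\ xs k 0 i != 0.
    apply: filterI; first exact: (cvgr_neq0 _ hG rel).
    by apply: filterI; exact: nz_near.
  have [k [k1 [k2 k3]]] := filter_ex hk.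
  have [y y0 vy] := vsE k; case/negP: k1; rewrite !vy ?inE//.
  by apply/eqP; ring.
apply: (mulIf D0); rewrite mulrAC divfK//; apply/eqP.
by rewrite -subr_eq0 rel.
Qed.


Lemma Theta_convex1 theta : convex_segments (Theta 1 theta : set 'rV[R]_n).
Proof.
move=> x y t /andP[t0 t1]; rewrite /Theta /= /phi => Tx Ty.
apply: (@le_trans _ _ ((1 - t) * theta + t * theta)); last first.
  by rewrite -mulrDl subrK mul1r.
have t1' : 0 <= 1 - t by rewrite subr_ge0.
apply: le_trans (lerD (ler_wpM2l t1' Tx) (ler_wpM2l t0 Ty)).
rewrite !mulr_sumr -big_split /=; apply: ler_sum => i _.
rewrite !powRr1// !mxE.
have -> : x 0 i + t * (y 0 i - x 0 i) = (1 - t) * x 0 i + t * y 0 i by ring.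
apply: (le_trans (ler_normD _ _)).
by rewrite !normrM (ger0_norm t0) (ger0_norm t1').
Qed.

(** On [Theta], the expansion of [phi] at the boundary point [x] bounds the sum
    [S] of the [`|y 0 i| `^ p] off the zero pattern of [x] by a multiple of
    [`|y - x|]. As [p < 1], each [y 0 i] off the pattern is then negligible with
    respect to [`|y - x|], whatever the entry [u 0 i]; and as [S >= 0], the
    part of [u] proportional to [dphi] contributes at most a negligible
    amount. *)
Lemma Theta_regular_normal_lt1 theta x u (y0 : R) : p < 1 -> phi p x = theta ->
  0 <= y0 -> (forall i, i \in nonzeros x -> u 0 i = y0 * dphi p x i) ->
  regular_normal_cone (Theta p theta) x u.
Proof.
move=> p1 phix y00 uE; apply/regular_normalP => e e0.
pose N : pred 'I_n := fun i => x 0 i != 0.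
pose g := face_grad N x.
have xN i : ~~ N i -> x 0 i = 0 by rewrite /N negbK => /eqP.
(* [e] is halved between the coordinates in [N], where [y0] multiplies the
   error, and the others, where the bounds [U] on [u] and [C * `|y - x|] on [S]
   are divided out *)
have e1 : 0 < e / (2 * (y0 + 1)) by rewrite divr_gt0// mulr_gt0// ltr_wpDl.
pose C := e / (2 * (y0 + 1)) + n.+1%:R * `|g|.
have C0 : 0 < C by rewrite ltr_wpDr// mulr_ge0.
pose U := `|u| + 1.
have U0 : 0 < U by rewrite ltr_wpDl.
have e2 : 0 < e / (2 * n.+1%:R * U * C) by rewrite divr_gt0// !mulr_gt0.
have small i : ~~ N i -> \forall y \near x,
    `|(y : 'rV[R]_n) 0 i| `^ (1 - p) < e / (2 * n.+1%:R * U * C).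
  move=> iN; have q0 : 0 < 1 - p by rewrite subr_gt0.
  have c0 : {for x, continuous (fun y : 'rV[R]_n => `|y 0 i| `^ (1 - p))}.
    apply: (@continuous_comp _ _ _ (fun y : 'rV[R]_n => y 0 i)
      (fun s => `|s| `^ (1 - p))); first exact: coord_continuous.
    exact: continuous_norm_powR.
  by apply: (cvgr_lt _ c0); rewrite xN// normr0 powR0// gt_eqF.
have small' : \forall y \near x, forall i, ~~ N i ->
    `|(y : 'rV[R]_n) 0 i| `^ (1 - p) < e / (2 * n.+1%:R * U * C).
  apply: near_fin_forall => i; case: (boolP (N i)) => Ni; first by near=> y.
  by apply: filterS (small i Ni).
have hpsi : \forall y \near x, setT y -> `|\sum_(i | N i) `|(y : 'rV[R]_n) 0 i| `^ p -
    \sum_(i | N i) `|x 0 i| `^ p - dot g (y - x)|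
    <= e / (2 * (y0 + 1)) * `|y - x|.
  exact: (@has_grad_partial_phi setT N x).
near=> y => Ty.
have hpsiy : `|\sum_(i | N i) `|y 0 i| `^ p -
    \sum_(i | N i) `|x 0 i| `^ p - dot g (y - x)|
    <= e / (2 * (y0 + 1)) * `|y - x| by have : setT y by []; near: y.
have smally : forall i, ~~ N i ->
    `|y 0 i| `^ (1 - p) < e / (2 * n.+1%:R * U * C) by near: y.
pose S := \sum_(i | ~~ N i) `|y 0 i| `^ p.
have S_le : dot g (y - x) + S <= e / (2 * (y0 + 1)) * `|y - x|.
  move: Ty; rewrite /Theta /= -phix (phi_split N y) (phi_face xN).
  move: hpsiy; rewrite ler_norml -/S => /andP[h _]; lra.
have S0 : 0 <= S by apply: sumr_ge0 => i _; exact: powR_ge0.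
have S_C : S <= C * `|y - x|.
  have := norm_dot_le g (y - x); rewrite ler_norml /C mulrDl => /andP[h _]; lra.
have off i : ~~ N i -> `|y 0 i| <= e / (2 * n.+1%:R * U) * `|y - x|.
  move=> iN; have -> : `|y 0 i| = `|y 0 i| `^ p * `|y 0 i| `^ (1 - p).
    have pp : p + (1 - p) = 1 by rewrite addrC subrK.
    by rewrite -powRD pp ?oner_eq0// powRr1.
  have yS : `|y 0 i| `^ p <= C * `|y - x|.
    apply: le_trans S_C; rewrite /S (bigD1 i)//= lerDl.
    by apply: sumr_ge0 => j _; exact: powR_ge0.
  apply: (le_trans (ler_pM (powR_ge0 _ _) (powR_ge0 _ _) yS (ltW (smally i iN)))).
  rewrite [X in X <= _](_ : _ = e / (2 * n.+1%:R * U) * `|y - x|)//.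
  by field; rewrite !gt_eqF.
have split_u : dot u (y - x) = y0 * dot g (y - x)
    + \sum_(i | ~~ N i) u 0 i * y 0 i.
  rewrite /dot (bigID N) /= [X in y0 * X](bigID N) /= [X in _ * (_ + X)]big1.
    rewrite addr0 mulr_sumr; congr (_ + _); apply: eq_bigr => i Ni.
      by rewrite uE ?inE// [g 0 i]mxE Ni mulrA.
    by rewrite !mxE xN// subr0.
  by move=> i /negbTE Ni; rewrite mxE Ni mul0r.
have b1 : y0 * dot g (y - x) <= e / 2 * `|y - x|.
  apply: (@le_trans _ _ (y0 * (e / (2 * (y0 + 1)) * `|y - x|))).
    by rewrite ler_wpM2l//; lra.
  rewrite mulrA ler_wpM2r//.
  have -> : y0 * (e / (2 * (y0 + 1))) = e / 2 * (y0 / (y0 + 1)).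
    by field; rewrite gt_eqF// ltr_wpDl.
  rewrite ler_piMr ?divr_ge0 ?(ltW e0)//.
  by rewrite ler_pdivrMr ?ltr_wpDl// mul1r lerDl.
have b2 : \sum_(i | ~~ N i) u 0 i * y 0 i <= e / 2 * `|y - x|.
  apply: (@le_trans _ _ (\sum_(i < n) e / (2 * n.+1%:R) * `|y - x|)).
    rewrite big_mkcond; apply: ler_sum => i _; case: ifPn => iN; last first.
      by rewrite mulr_ge0// divr_ge0 ?(ltW e0)// mulr_ge0.
    apply: (le_trans (ler_norm _)); rewrite normrM.
    apply: (@le_trans _ _ (U * (e / (2 * n.+1%:R * U) * `|y - x|))).
      apply: ler_pM => //; last exact: off.
      by rewrite (le_trans (coord_le_norm _ _))// lerDl.
    rewrite [X in X <= _](_ : _ = e / (2 * n.+1%:R) * `|y - x|)//.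
    by field; rewrite !gt_eqF.
  rewrite sumr_const card_ord -[X in X <= _]mulr_natl.
  have -> : e / 2 * `|y - x| = n.+1%:R * (e / (2 * n.+1%:R) * `|y - x|).
    by field; rewrite gt_eqF.
  by rewrite ler_wpM2r ?ler_nat// mulr_ge0// divr_ge0 ?(ltW e0)// mulr_ge0.
rewrite split_u; lra.
Unshelve. all: by end_near. Qed.

End Phi.

Lemma Theta_normal_regular (R : realType) (n : nat) (p theta : R) (x : 'rV[R]_n) :
  0 < p -> p <= 1 -> x != 0 -> phi p x = theta ->
  normal_cone (Theta p theta) x `<=` regular_normal_cone (Theta p theta) x.
Proof.
move=> p0; rewrite le_eqVlt => /predU1P[->|p1] x0 phix v Nv.
  apply: convex_normal_regular Nv; first exact: Theta_convex1.
  by rewrite /Theta /= phix.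
have [y0 y00 vE] := Theta_normal p0 x0 Nv.
exact: Theta_regular_normal_lt1 vE.
Qed.

(** * Multipliers *)

Section Problem.
Context {R : realType} {n : nat} {I E : finType}.
Context (p theta : R) (f0 : 'rV[R]_n -> R).
Context (fI : I -> 'rV[R]_n -> R) (fE : E -> 'rV[R]_n -> R) (xb : 'rV[R]_n).
Context (p_gt0 : 0 < p).

Lemma Theta_boundary_phi : boundary (Theta p theta) xb -> Theta p theta xb ->
  phi p xb = theta.
Proof.
move=> [_ nint] Tx; apply/eqP; rewrite eq_le [X in X && _]Tx /= leNgt.
apply/negP => lt; apply: nint.
suff : nbhs xb (Theta p theta) by [].
have h : \forall y \near xb, phi p y < theta.
  exact: (cvgr_lt _ (@phi_continuous _ _ _ p_gt0 xb) theta lt).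
by apply: filterS h => y /ltW.
Qed.

(** Testing the equation with the direction [d] of EMFCQ leaves a sum of
    nonpositive terms, which all vanish; as [d] is strict for [phi] and for the
    active inequalities, so do their multipliers, and what remains is a linear
    relation between independent gradients. *)
Lemma EMFCQ_dual (y0 : R) (yI : I -> R) (yE : E -> R) :
  EMFCQ p fI fE xb -> 0 <= y0 ->
  (forall j, j \in active fI xb -> 0 <= yI j) ->
  (forall i, i \in nonzeros xb ->
    y0 * dphi p xb i + (\sum_(j in active fI xb) yI j * grad (fI j) xb 0 i
      + \sum_j yE j * grad (fE j) xb 0 i) = 0) ->
  [/\ y0 = 0, forall j, j \in active fI xb -> yI j = 0 & forall j, yE j = 0].
Proof.
set N := nonzeros xb.
move=> [freeE [d [d0 dE dI]]] y00 yI0 h.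
pose gphi : 'rV[R]_n := \row_i dphi p xb i.
have hv : y0 *: subvec N gphi
    + (\sum_(j in active fI xb) yI j *: subvec N (grad (fI j) xb)
    + \sum_j yE j *: subvec N (grad (fE j) xb)) = 0.
  apply/rowP => k; rewrite !mxE !summxE -[RHS](h (enum_val k) (enum_valP k)).
  by congr (_ + (_ + _)); apply: eq_bigr => j _; rewrite !mxE.
have dot_sum (J : finType) (P : pred J) (c : J -> R) (F : J -> 'rV[R]_#|N|) :
    dot (\sum_(j | P j) c j *: F j) d = \sum_(j | P j) c j * dot (F j) d.
  elim/big_rec2 : _ => [|j a v _ <-]; first exact: dot0l.
  by rewrite dotDl dotZl.
have := congr1 (fun v => dot v d) hv.
rewrite /= !dotDl dotZl !dot_sum dot0l [X in _ + (_ + X)]big1; last first.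
  by move=> j _; rewrite dE mulr0.
rewrite addr0 => hd.
have termI j : j \in active fI xb ->
    yI j * dot (subvec N (grad (fI j) xb)) d <= 0.
  by move=> ja; rewrite mulr_ge0_le0 ?yI0 // ltW // dI.
have sI : \sum_(j in active fI xb) yI j * dot (subvec N (grad (fI j) xb)) d <= 0.
  exact: sumr_le0.
have t0 : y0 * dot (subvec N gphi) d <= 0 by rewrite mulr_ge0_le0// ltW.
have y0E : y0 = 0.
  have /eqP : y0 * dot (subvec N gphi) d = 0 by lra.
  by rewrite mulf_eq0 (lt_eqF d0) orbF => /eqP.
have yIE j : j \in active fI xb -> yI j = 0.
  move=> ja.
  have /eqP : \sum_(j in active fI xb)
      - (yI j * dot (subvec N (grad (fI j) xb)) d) = 0.
    by rewrite sumrN; lra.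
  rewrite psumr_eq0 => [/allP/(_ j (mem_index_enum _))|j' /termI]; last first.
    by rewrite oppr_ge0.
  by rewrite ja /= oppr_eq0 mulf_eq0 (lt_eqF (dI j ja)) orbF => /eqP.
split=> //.
have hE : \sum_j yE j *: subvec N (grad (fE j) xb) = 0.
  move: hv; rewrite y0E scale0r add0r [X in X + _]big1 ?add0r// => j ja.
  by rewrite yIE// scale0r.
pose X := [tuple of [seq subvec N (grad (fE j) xb) | j : E]].
have /freeP fX : free X by [].
move=> j; rewrite -(enum_rankK j); apply: (fX (fun k => yE (enum_val k))).
rewrite -[RHS]hE (reindex (fun k : 'I_#|E| => enum_val k)) /=; last first.
  exact/onW_bij/enum_val_bij.
by apply: eq_bigr => k _; rewrite nth_image.
Qed.

End Problem.

Lemma grad_coord_continuous (R : realType) (n : nat) (f : 'rV[R]_n -> R) x i :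
  C1 f -> (grad f y 0 i) @[y --> x] --> grad f x 0 i.
Proof.
move=> [_ cf]; apply: (@continuous_comp _ _ _ (grad f)
  (fun y : 'rV[R]_n => y 0 i)); first exact: cf.
exact: coord_continuous.
Qed.

(** The Fritz John conditions on the face of [xb], with [phi y - theta] as one
    more inequality. *)
Lemma EMFCQ_multipliers (R : realType) (n : nat) (I E : finType) (p theta : R)
    (f0 : 'rV[R]_n -> R) (fI : I -> 'rV[R]_n -> R) (fE : E -> 'rV[R]_n -> R)
    (xb : 'rV[R]_n) :
  0 < p -> C1 f0 -> (forall j, C1 (fI j)) -> (forall j, C1 (fE j)) ->
  local_minimizer f0 (Theta p theta `&` Gamma fI fE) xb ->
  EMFCQ p fI fE xb ->
  exists (y0 : R) (yI : I -> R) (yE : E -> R),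
    [/\ 0 <= y0, forall j, j \in active fI xb -> 0 <= yI j &
        forall i, i \in nonzeros xb ->
          grad f0 xb 0 i + y0 * dphi p xb i
          + (\sum_(j in active fI xb) yI j * grad (fI j) xb 0 i
             + \sum_(j : E) yE j * grad (fE j) xb 0 i) = 0].
Proof.
move=> p_gt0 cf0 cfI cfE [[Txb [GI GE]] xmin] CQ.
pose N : pred 'I_n := fun i => i \in nonzeros xb.
have NE i : N i = (xb 0 i != 0) by rewrite /N inE.
pose g (o : unit + I + E) := match o with
  | inl (inl _) => fun y : 'rV[R]_n => phi p y - theta
  | inl (inr j) => fI j | inr j => fE j end.
pose dg (o : unit + I + E) := match o with
  | inl (inl _) => fun y : 'rV[R]_n => face_grad p N y
  | inl (inr j) => grad (fI j) | inr j => grad (fE j) end.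
pose ineq (o : unit + I + E) := if o is inl _ then true else false.
have [||||||||l0 [l [lnz l0_ge0 l_ge0 l_compl l_eq]]] :=
    @fritz_john R n _ N f0 g ineq (grad f0) dg xb.
- exact: C1_continuous.
- case=> [[t|j]|j]; [|exact: C1_continuous (cfI j)|exact: C1_continuous (cfE j)].
  move=> x; apply: continuous_at_add; first exact: phi_continuous.
  exact: cst_continuous.
- by near=> u => _; exact: C1_has_grad.
- case=> [[t|j]|j]; [|by near=> u => _; exact: C1_has_grad (cfI j)
    |by near=> u => _; exact: C1_has_grad (cfE j)].
  have nz : \forall u \near xb, forall i, N i -> (u : 'rV[R]_n) 0 i != 0.
    apply: near_fin_forall => i; case: (boolP (N i)) => Ni; last by near=> u.
    have xi : xb 0 i != 0 by rewrite -NE.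
    have h : \forall u \near xb, (u : 'rV[R]_n) 0 i != 0.
      exact: (cvgr_neq0 _ (@coord_continuous R 1 n 0 i xb) xi).
    by apply: filterS h.
  apply: filterS nz => u nz Au.
  rewrite /= -[face_grad p N u]addr0; apply: has_gradD; last exact: has_grad_cst.
  apply: has_grad_phi => // y Ay i Ni.
  by rewrite Ay//; apply/eqP; move: Ni; rewrite NE negbK.
- by move=> i _; exact: grad_coord_continuous.
- case=> [[t|j]|j] i Ni; [|exact: grad_coord_continuous (cfI j)
    |exact: grad_coord_continuous (cfE j)].
  rewrite /= mxE Ni; under eq_cvg do rewrite mxE Ni.
  by apply: dphi_continuous; rewrite -NE.
- by move=> [[[]|j]|j] /=; [rewrite subr_le0 | exact: GI | apply/eqP; exact: GE].
- apply: filterS xmin => y ymin _ yf; apply: ymin; split.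
    by have := yf (inl (inl tt)); rewrite /= subr_le0.
  by split=> j; [exact: yf (inl (inr j)) | apply/eqP; exact: yf (inr j)].
pose lI j := l (inl (inr j)); pose lE j := l (inr j).
have {}l_eq i : i \in nonzeros xb -> l0 * grad f0 xb 0 i
    + (l (inl (inl tt)) * dphi p xb i
    + (\sum_(j in active fI xb) lI j * grad (fI j) xb 0 i
       + \sum_j lE j * grad (fE j) xb 0 i)) = 0.
  move=> Ni; rewrite -[RHS](l_eq i Ni) !big_sumType /=; congr (_ + _).
  rewrite addrA; congr (_ + _); congr (_ + _).
    rewrite (bigD1 tt)//= big1 ?addr0 => [|[]//].
    by rewrite mxE /N Ni.
  rewrite big_mkcond; apply: eq_bigr => j _; case: ifPn => // ja.
  rewrite l_compl ?mul0r//=; rewrite lt_neqAle GI andbT.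
  by move: ja; rewrite inE.
have l0_neq0 : l0 != 0.
  apply/eqP => l00.
  have [||y00 yI0 yE0] := @EMFCQ_dual _ _ _ _ p fI fE xb _ lI lE CQ
    (l_ge0 (inl (inl tt)) isT).
  - by move=> j _; exact: l_ge0.
  - by move=> i Ni; have := l_eq i Ni; rewrite l00 mul0r add0r.
  case: lnz => [|[[[[]|j]|j]]]; rewrite ?l00 ?y00 ?eqxx//.
  - have [ja|ja] := boolP (j \in active fI xb).
      by rewrite -/(lI j) yI0// eqxx.
    rewrite l_compl ?eqxx//= lt_neqAle GI andbT.
    by move: ja; rewrite inE.
  - by rewrite -/(lE j) yE0 eqxx.
exists (l (inl (inl tt)) / l0), (fun j => lI j / l0), (fun j => lE j / l0).
split=> [|j _|i Ni]; try by rewrite divr_ge0// l_ge0.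
have sumE (J : finType) (P : pred J) (c F : J -> R) :
    \sum_(j | P j) c j / l0 * F j = (\sum_(j | P j) c j * F j) / l0.
  by rewrite mulr_suml; apply: eq_bigr => j _; rewrite mulrAC.
rewrite !sumE; apply: (mulfI l0_neq0); rewrite mulr0 -[RHS](l_eq i Ni).
by field.
Unshelve. all: by end_near. Qed.

Lemma local_minimizer_normal (R : realType) (n : nat) (f : 'rV[R]_n -> R) C x :
  C1 f -> local_minimizer f C x -> regular_normal_cone C x (- grad f x).
Proof.
move=> cf [_ fmin]; apply/regular_normalP => e e0.
have h := @C1_has_grad R n setT f x cf e e0.
apply: filterS2 h fmin => y + + Cy; move=> /(_ I) h /(_ Cy) fxy.
by rewrite dotNl; move: h; rewrite ler_norml => /andP[_]; lra.
Qed.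

Lemma convex_set_segments (R : realType) (n : nat) (C : set 'rV[R]_n) :
  convex_set (C : set (convex_lmodType 'rV[R]_n)) -> convex_segments C.
Proof.
move=> cC x y t /andP[t0 t1] Cx Cy.
have := cC y x (Itv01 t0 t1) (mem_set Cy) (mem_set Cx) => /set_mem.
suff -> : x + t *: (y - x) = t *: y + (1 - t) *: x by [].
by apply/rowP => i; rewrite !mxE; ring.
Qed.


Theorem theorem2p6 (R : realType) (n : nat) (I E : finType) (p theta : R)
    (f0 : 'rV[R]_n -> R) (fI : I -> 'rV[R]_n -> R) (fE : E -> 'rV[R]_n -> R)
    (xbar : 'rV[R]_n)
    (p_gt0 : 0 < p) (p_le1 : p <= 1) (theta_gt0 : 0 < theta)
    (f0_C1 : C1 f0) (fI_C1 : forall j, C1 (fI j)) (fE_C1 : forall j, C1 (fE j))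
    (xbar_bd : boundary (Theta p theta) xbar)
    (xbar_min : local_minimizer f0 (Theta p theta `&` Gamma fI fE) xbar) :
  [/\ (* (a) *)
      EMFCQ p fI fE xbar ->
      exists (y0 : R) (yI : I -> R) (yE : E -> R),
        [/\ 0 <= y0, forall j, j \in active fI xbar -> 0 <= yI j &
            forall i, i \in nonzeros xbar ->
              grad f0 xbar 0 i
              + y0 * dphi p xbar i
              + (\sum_(j in active fI xbar) yI j * grad (fI j) xbar 0 i
                 + \sum_(j : E) yE j * grad (fE j) xbar 0 i) = 0],
      (* (b) *)
      closed (Gamma fI fE) ->
      convex_set (Gamma fI fE : set (convex_lmodType 'rV[R]_n)) ->
      (forall v, normal_cone (Theta p theta) xbar v ->
                 normal_cone (Gamma fI fE) xbar (- v) -> v = 0) ->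
      normal_cone (Theta p theta `&` Gamma fI fE) xbar =
        [set u + v | u in normal_cone (Theta p theta) xbar
                   & v in normal_cone (Gamma fI fE) xbar] /\
      exists (y0 : R) (v : 'rV[R]_n),
        [/\ 0 <= y0, normal_cone (Gamma fI fE) xbar v &
            forall i, i \in nonzeros xbar ->
              grad f0 xbar 0 i
              + y0 * dphi p xbar i
              + v 0 i = 0]
    & (* (c) *)
      Gamma fI fE = setT ->
      exists2 y0 : R, 0 <= y0 &
        forall i, i \in nonzeros xbar ->
          grad f0 xbar 0 i
          + y0 * dphi p xbar i = 0].
Proof.
have [[Txb Gxb] _] := xbar_min.
have phix := Theta_boundary_phi p_gt0 xbar_bd Txb.
have x_neq0 : xbar != 0.
  apply: contraTneq theta_gt0 => x0; rewrite -phix x0 /phi big1 ?ltxx// => i _.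
  by rewrite mxE normr0 powR0// gt_eqF.
have Nmin := local_minimizer_normal f0_C1 xbar_min.
split.
- exact: (EMFCQ_multipliers p_gt0 f0_C1 fI_C1 fE_C1 xbar_min).
- move=> cG convG CQ.
  have cT : closed (Theta p theta : set 'rV[R]_n).
    exact (closed_sublevel (phi_continuous p_gt0)).
  have sumN : normal_cone (Theta p theta `&` Gamma fI fE) xbar =
      [set u + v | u in normal_cone (Theta p theta) xbar
                 & v in normal_cone (Gamma fI fE) xbar].
    apply: normal_cone_setI => //; first exact: Theta_normal_regular.
    by apply: convex_normal_regular => //; exact: convex_set_segments.
  split=> //.
  have : normal_cone (Theta p theta `&` Gamma fI fE) xbar (- grad f0 xbar).
    exact: regular_normal_normal.
  rewrite sumN => -[u Nu [v Nv uv]].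
  have [y0 y0_ge0 uE] := Theta_normal p_gt0 x_neq0 Nu.
  exists y0, v; split=> // i Ni; rewrite -uE//.
  have := congr1 (fun w : 'rV[R]_n => w 0 i) uv.
  by rewrite [LHS]mxE [RHS]mxE -addrA => ->; rewrite subrr.
- move=> GT; rewrite GT setIT in Nmin.
  have [y0 y0_ge0 h] := Theta_regular_normal p_gt0 Txb Nmin.
  by exists y0 => // i Ni; have := h i Ni; rewrite mxE => <-; rewrite subrr.
Qed.
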